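(* Let $u$ be the value function of the pursuit-evasion game with target $\mathcal{T}$, and for $i=1,\dots,m$ let $u_i$ be the value function of the game with the same dynamics and controls but with target $\mathcal{T}_i$ in place of $\mathcal{T}$ (all as defined in the context, under hypothesis (H) stated there). For $x\in\mathbb{R}^N$ set $$I(x):=\{i\in\{1,\dots,m\} : u_i(x)=\min_{1\le j\le m}u_j(x)\}.$$ Assume that for every $x\in\mathbb{R}^N\setminus\mathcal{T}$, every family of convex weights $\{\lambda_i\}_{i\in I(x)}$ (that is, $\lambda_i\ge 0$ and $\sum_{i\in I(x)}\lambda_i=1$) and every family of vectors $\{\xi_i\}_{i\in I(x)}$ with $\xi_i\in\partial^L u_i(x)$ for each $i\in I(x)$, one has $$H\Big(x,\sum_{i\in I(x)}\lambda_i\xi_i\Big)\le\sum_{i\in I(x)}\lambda_i H(x,\xi_i).$$ Then $$u(x)=\min\{u_1(x),\dots,u_m(x)\}\qquad\text{for all }x\in\mathbb{R}^N\setminus\mathcal{T}.$$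
   Context: Setting. Let $n,m\ge1$ be integers and $N=nm$. The state is $y=(y_1,\dots,y_m)\in\mathbb{R}^N$ with $y_i\in\mathbb{R}^n$. The dynamics are $$y_i'(t)=-g_i(y(t))a_i(t)+h_i(y(t))b(t)+l_i(y(t)),\qquad i=1,\dots,m,$$ where $g_i,h_i:\mathbb{R}^N\to\mathbb{R}$ are positive functions and $l_i:\mathbb{R}^N\to\mathbb{R}^n$. The pursuers' control $a=(a_1,\dots,a_m)$ takes values in $A=B_n(0,\rho_a)\times\cdots\times B_n(0,\rho_a)$ ($m$ factors) and the evader's control $b$ takes values in $B=B_n(0,\rho_b)$, where $B_n(0,\rho)$ is the closed Euclidean ball in $\mathbb{R}^n$ of radius $\rho$ centred at $0$ and $\rho_a,\rho_b>0$ are given. $\mathcal{A}$ and $\mathcal{B}$ denote the sets of measurable functions $[0,\infty)\to A$ and $[0,\infty)\to B$ respectively. $|\cdot|$ is the Euclidean norm. Hypothesis (H): $g_i,h_i,l_i$ ($i=1,\dots,m$) are Lipschitz continuous, and $g_i(x)\rho_a-h_i(x)\rho_b-|l_i(x)|>0$ for all $x\in\mathbb{R}^N$ and all $i$. Targets. Let $r\ge0$. Put $\mathcal{T}=\{(y_1,\dots,y_m)\in\mathbb{R}^N:\min_{1\le i\le m}|y_i|\le r\}$ and $\mathcal{T}_i=\{(y_1,\dots,y_m)\in\mathbb{R}^N:|y_i|\le r\}$, so that $\mathcal{T}=\bigcup_i\mathcal{T}_i$. Value function. For a target $\mathcal{S}$ (either $\mathcal{T}$ or some $\mathcal{T}_i$),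 an initial state $x$ and controls $a\in\mathcal{A}$, $b\in\mathcal{B}$, let $y_x(\cdot;a,b)$ be the solution of the dynamics with $y_x(0)=x$, and let $t_x(a,b)=\min\{t\ge 0:y_x(t;a,b)\in\mathcal{S}\}$, with $t_x(a,b)=+\infty$ if the target is never reached. The cost is $J(x,a,b)=\psi(t_x(a,b))$ where $\psi(s)=1-e^{-s}$ for $s<\infty$ and $\psi(+\infty)=1$. The $a$-player minimizes and the $b$-player maximizes. Non-anticipative strategies: $\Gamma$ is the set of maps $\alpha:\mathcal{B}\to\mathcal{A}$ such that, for every $t>0$, $b=\tilde b$ on $[0,t]$ implies $\alpha[b]=\alpha[\tilde b]$ on $[0,t]$; $\Delta$ is the set of maps $\beta:\mathcal{A}\to\mathcal{B}$ with the analogous property. The upper and lower values are $\sup_{\beta\in\Delta}\inf_{a\in\mathcal{A}}J(x,a,\beta[a])$ and $\inf_{\alpha\in\Gamma}\sup_{b\in\mathcal{B}}J(x,\alpha[b],b)$; they coincide, and the common value is the value function of the game with target $\mathcal{S}$. Hamiltonian. For $x\in\mathbb{R}^N$ and $p=(p_1,\dots,p_m)\in\mathbb{R}^N$ with $p_i\in\mathbb{R}^n$, $$H(x,p)=\rho_a\sum_{i=1}^m g_i(x)|p_i|-\rho_b\Big|\sum_{i=1}^m h_i(x)p_i\Big|-\sum_{i=1}^m l_i(x)\cdot p_i-1.$$ Background facts taken as known under (H): $u$ is the unique uniformly continuous function on $\mathbb{R}^N$ that vanishes on $\mathcal{T}$ and is a viscosity solution of $u(x)+H(x,Du(x))=0$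 on $\mathbb{R}^N\setminus\mathcal{T}$; each $u_i$ is a viscosity solution of $u_i(x)+H(x,Du_i(x))=0$ on $\mathbb{R}^N\setminus\mathcal{T}_i$ with $u_i=0$ on $\mathcal{T}_i$; the functions $u_i$ are Lipschitz continuous. Superdifferentials. For $w:\mathbb{R}^N\to\mathbb{R}$, the Fréchet superdifferential is $$\partial^F w(x)=\Big\{p\in\mathbb{R}^N:\limsup_{x'\to x}\frac{w(x')-w(x)-p\cdot(x'-x)}{|x'-x|}\le0\Big\},$$ and the limiting superdifferential $\partial^L w(x)$ is the set of all limits $p=\lim_j p_j$ with $p_j\in\partial^F w(x_j)$ for some sequence $x_j\to x$. *)

(* Defs.v *)
From HB Require Import structures.
From mathcomp Require Import all_boot all_order all_algebra.
From mathcomp Require Import all_classical all_reals all_analysis.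

Set Implicit Arguments.
Unset Strict Implicit.
Unset Printing Implicit Defensive.

Import Order.TTheory GRing.Theory Num.Theory.
Import numFieldNormedType.Exports.

Local Open Scope classical_set_scope.
Local Open Scope ring_scope.

(* A state (y_1, ..., y_m) with y_i in R^n is a matrix whose i-th row is y_i.
   The numbers m.+1 and n.+1 stand for the integers m, n >= 1 of the text. *)
Notation state R m n := 'M[R]_(m.+1, n.+1).

(* Euclidean structure on R^q (p = 1) and on R^N seen as matrices; the norm
   `|_| that the library puts on matrices is the sup norm. *)
Definition dotp (R : realType) (p q : nat) (x y : 'M[R]_(p, q)) : R :=
  \sum_i \sum_j x i j * y i j.

Definition enorm (R : realType) (p q : nat) (x : 'M[R]_(p, q)) : R :=
  Num.sqrt (dotp x x).

Definition minf (R : realType) (m : nat) (F : 'I_m.+1 -> R) : R :=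
  \big[Num.min/F ord0]_(i < m.+1) F i.

Record game (R : realType) (m n : nat) := Game {
  gcoef : 'I_m.+1 -> state R m n -> R;
  hcoef : 'I_m.+1 -> state R m n -> R;
  ldrift : 'I_m.+1 -> state R m n -> 'rV[R]_n.+1;
  rhoa : R;
  rhob : R }.

(* All norms on R^N being equivalent, Lipschitz continuity for the library norm
   is Lipschitz continuity for the Euclidean one. *)
Definition hypH (R : realType) (m n : nat) (G : game R m n) : Prop :=
  [/\ 0 < rhoa G /\ 0 < rhob G,
      forall i x, 0 < gcoef G i x /\ 0 < hcoef G i x,
      forall i, [/\ lipschitz (gcoef G i), lipschitz (hcoef G i)
                    & lipschitz (ldrift G i)]
    & forall i x, 0 < gcoef G i x * rhoa G - hcoef G i x * rhob G
                      - enorm (ldrift G i x)].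

Definition dynamics (R : realType) (m n : nat) (G : game R m n)
    (y a : state R m n) (b : 'rV[R]_n.+1) : state R m n :=
  \matrix_(i, j) (- (gcoef G i y * a i j) + hcoef G i y * b ord0 j
                  + ldrift G i y ord0 j).

(* R with the sigma-algebra of Lebesgue measurable sets, the domain of
   completed_lebesgue_measure. *)
Notation lebesgueType R :=
  (caratheodory_type ((@wlength R idfun)^*)%mu).

Definition lebesgue_measurable_ge0 (R : realType) (f : R -> R) : Prop :=
  measurable_fun (`[0%R, +oo[%classic : set (lebesgueType R))
                 (f : lebesgueType R -> R).

(* Controls are functions on [0, +oo[ : their values at t < 0 are irrelevant. *)
Definition pursuer_control (R : realType) (m n : nat) (G : game R m n) :
    set (R -> state R m n) :=
  [set a : R -> state R m n | (forall i j, lebesgue_measurable_ge0 (fun t => a t i j)) /\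
           (forall t, 0 <= t -> forall i, enorm (row i (a t)) <= rhoa G)].

Definition evader_control (R : realType) (m n : nat) (G : game R m n) :
    set (R -> 'rV[R]_n.+1) :=
  [set b : R -> 'rV[R]_n.+1 | (forall j, lebesgue_measurable_ge0 (fun t => b t ord0 j)) /\
           (forall t, 0 <= t -> enorm (b t) <= rhob G)].

(* Caratheodory solutions: continuous solutions of the integral equation. *)
Definition is_trajectory (R : realType) (m n : nat) (G : game R m n)
    (x : state R m n) (a : R -> state R m n) (b : R -> 'rV[R]_n.+1)
    (y : R -> state R m n) : Prop :=
  {within `[0, +oo[, continuous y} /\
  forall t, 0 <= t -> forall i j,
    y t i j = x i j + \int[@completed_lebesgue_measure R]_(s in `[0, t])
                        dynamics G (y s) (a s) (b s) i j.

Definition trajectory (R : realType) (m n : nat) (G : game R m n)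
    (x : state R m n) (a : R -> state R m n) (b : R -> 'rV[R]_n.+1) :
    R -> state R m n :=
  get (is_trajectory G x a b).

(* The infimum of the empty set is +oo; for a closed target and a continuous
   trajectory a finite infimum is attained. *)
Definition hitting_time (R : realType) (m n : nat) (S : set (state R m n))
    (y : R -> state R m n) : \bar R :=
  ereal_inf [set t%:E | t in [set t | 0 <= t /\ S (y t)]].

Definition psi (R : realType) (s : \bar R) : R :=
  match s with
  | s%:E => 1 - expR (- s)
  | +oo%E => 1
  | -oo%E => 0 (* hitting times are nonnegative: never used *)
  end.

Definition cost (R : realType) (m n : nat) (G : game R m n)
    (S : set (state R m n)) (x : state R m n)
    (a : R -> state R m n) (b : R -> 'rV[R]_n.+1) : R :=
  psi (hitting_time S (trajectory G x a b)).

Definition nonanticipative (R : realType) (U V : Type)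
    (CU : set (R -> U)) (CV : set (R -> V)) : set ((R -> U) -> (R -> V)) :=
  [set s : (R -> U) -> (R -> V) | (forall c, CU c -> CV (s c)) /\
           (forall t, 0 < t -> forall c c', CU c -> CU c' ->
              (forall tau, 0 <= tau <= t -> c tau = c' tau) ->
              forall tau, 0 <= tau <= t -> s c tau = s c' tau)].

Definition pursuer_strategy (R : realType) (m n : nat) (G : game R m n) :=
  nonanticipative (evader_control G) (pursuer_control G).

Definition evader_strategy (R : realType) (m n : nat) (G : game R m n) :=
  nonanticipative (pursuer_control G) (evader_control G).

Definition upper_value (R : realType) (m n : nat) (G : game R m n)
    (S : set (state R m n)) (x : state R m n) : R :=
  sup [set inf [set cost G S x a (beta a) | a in pursuer_control G]
      | beta in evader_strategy G].

Definition lower_value (R : realType) (m n : nat) (G : game R m n)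
    (S : set (state R m n)) (x : state R m n) : R :=
  inf [set sup [set cost G S x (alpha b) b | b in evader_control G]
      | alpha in pursuer_strategy G].

Definition is_value_function (R : realType) (m n : nat) (G : game R m n)
    (S : set (state R m n)) (v : state R m n -> R) : Prop :=
  forall x, upper_value G S x = v x /\ lower_value G S x = v x.

Definition target (R : realType) (m n : nat) (r : R) : set (state R m n) :=
  [set y : state R m n | minf (fun i => enorm (row i y)) <= r].

Definition target_of (R : realType) (m n : nat) (r : R) (i : 'I_m.+1) :
    set (state R m n) :=
  [set y : state R m n | enorm (row i y) <= r].

Definition hamiltonian (R : realType) (m n : nat) (G : game R m n)
    (x p : state R m n) : R :=
  rhoa G * (\sum_i gcoef G i x * enorm (row i p))
  - rhob G * enorm (\sum_i hcoef G i x *: row i p)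
  - \sum_i dotp (ldrift G i x) (row i p) - 1.

(* phi is of class C^1 with gradient dphi.  Viscosity sub/supersolutions are
   defined by local extrema, so that taking test functions in C^1(R^N) or in
   C^1(Omega) makes no difference. *)
Definition C1_with_gradient (R : realType) (m n : nat)
    (phi : state R m n -> R) (dphi : state R m n -> state R m n) : Prop :=
  (forall x, is_diff x phi (dotp (dphi x))) /\ continuous dphi.

Definition viscosity_subsolution (R : realType) (m n : nat)
    (H : state R m n -> state R m n -> R) (Omega : set (state R m n))
    (v : state R m n -> R) : Prop :=
  forall phi dphi, C1_with_gradient phi dphi -> forall x, Omega x ->
    (\forall y \near x, v y - phi y <= v x - phi x) ->
    v x + H x (dphi x) <= 0.

Definition viscosity_supersolution (R : realType) (m n : nat)
    (H : state R m n -> state R m n -> R) (Omega : set (state R m n))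
    (v : state R m n -> R) : Prop :=
  forall phi dphi, C1_with_gradient phi dphi -> forall x, Omega x ->
    (\forall y \near x, v x - phi x <= v y - phi y) ->
    0 <= v x + H x (dphi x).

(* Viscosity solutions of v(x) + H(x, Dv(x)) = 0 in the open set Omega. *)
Definition viscosity_solution (R : realType) (m n : nat)
    (H : state R m n -> state R m n -> R) (Omega : set (state R m n))
    (v : state R m n -> R) : Prop :=
  [/\ forall x, Omega x -> {for x, continuous v},
      viscosity_subsolution H Omega v
    & viscosity_supersolution H Omega v].

Definition solves_dirichlet (R : realType) (m n : nat) (G : game R m n)
    (S : set (state R m n)) (v : state R m n -> R) : Prop :=
  (forall x, S x -> v x = 0) /\ viscosity_solution (hamiltonian G) (~` S) v.

Definition frechet_superdiff (R : realType) (m n : nat)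
    (w : state R m n -> R) (x : state R m n) : set (state R m n) :=
  [set p | (limf_esup
     (fun x' => ((w x' - w x - dotp p (x' - x)) / enorm (x' - x))%:E) x^'
     <= 0)%E].

Definition limiting_superdiff (R : realType) (m n : nat)
    (w : state R m n -> R) (x : state R m n) : set (state R m n) :=
  [set p | exists xs ps : nat -> state R m n,
     [/\ forall k, frechet_superdiff w (xs k) (ps k),
         xs @ \oo --> x & ps @ \oo --> p]].

Definition active (R : realType) (m n : nat)
    (us : 'I_m.+1 -> state R m n -> R) (x : state R m n) : {set 'I_m.+1} :=
  [set i | us i x == minf (us ^~ x)]%SET.

(* Main.v *)
From HB Require Import structures.
Require Import Defs.
From mathcomp Require Import all_boot all_order all_algebra.
From mathcomp Require Import all_classical all_reals all_analysis.
From mathcomp Require Import ring lra.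
Import Order.TTheory GRing.Theory Num.Theory.
Import numFieldNormedType.Exports.
Local Open Scope classical_set_scope.
Local Open Scope ring_scope.

(** Put v = min_i u_i.  By uniqueness for the Dirichlet problem of the game with
    the full target it suffices to check that v is uniformly continuous, vanishes on
    the target and solves the equation outside it.  The u_i share a
    Lipschitz constant, hence so does v; costs are nonnegative, hence v is, and
    v <= u_i = 0 on the i-th target.  At a point where v - phi has a local
    minimum, every active u_i has u_i - phi locally minimal, so v is a
    supersolution ([min_supersolution]).

    The substance is the subsolution property ([min_subsolution]).  If v - phi
    has a local maximum at x, then D phi(x) is a convex combination
    sum_i lam_i xi_i over the active indices, where xi_i is a limit of gradients
    p of quadratic functions that touch u_i from above at points near x
    ([min_superdiff_rule]).  A quadratic function is a C^1 test function, so
    u_i + H(., p) <= 0 at the touching points, and in the limit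
    H(x, xi_i) <= - u_i(x) = - v(x).  Each xi_i lies in the limiting
    superdifferential of u_i, so the convexity hypothesis on H gives
    H(x, D phi(x)) <= sum_i lam_i H(x, xi_i) <= - v(x).

    The decomposition of D phi(x) is first proved up to an arbitrary error
    ([fuzzy_min_rule]).  Near x the minimum lies below an explicit quadratic
    function q up to a small cone.  One decouples the arguments of the u_i,
    introduces a level t that replaces the minimum, and maximizes
      t - K sum_i ((t - u_i(x_i) + q(y))^+)^2 - A sum_i |x_i - y|^2
    over t, y and all x_i.  For large K and A the maximizer is interior.
    Stationarity in t says that the numbers lam_i = 2 K (t - u_i(x_i) + q(y))^+
    are convex weights.  Stationarity in y says that the gradient of q is
    sum_i 2 A (x_i - y).  Maximality in x_i says that lam_i u_i is touched from
    above at x_i by a quadratic function with gradient 2 A (x_i - y); this uses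
    that u_i is Lipschitz and that the derivative of the penalty is Lipschitz.
    Then the error is sent to 0.  The weights are bounded, and so are the
    gradients ([quad_touch_bounded]); limits are taken along an ultrafilter,
    which serves all the indices at once. *)

Set Implicit Arguments.
Unset Strict Implicit.
Unset Printing Implicit Defensive.

(** * Euclidean structure on matrices *)

Lemma dotpC (R : realType) p q (x y : 'M[R]_(p, q)) : dotp x y = dotp y x.
Proof. by apply: eq_bigr => i _; apply: eq_bigr => j _; rewrite mulrC. Qed.

Lemma dotpDl (R : realType) p q (x y z : 'M[R]_(p, q)) :
  dotp (x + y) z = dotp x z + dotp y z.
Proof.
rewrite /dotp -big_split; apply: eq_bigr => i _; rewrite -big_split.
by apply: eq_bigr => j _; rewrite mxE mulrDl.
Qed.

Lemma dotpZl (R : realType) p q a (x z : 'M[R]_(p, q)) :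
  dotp (a *: x) z = a * dotp x z.
Proof.
rewrite /dotp big_distrr; apply: eq_bigr => i _; rewrite big_distrr.
by apply: eq_bigr => j _; rewrite mxE -mulrA.
Qed.

Lemma dotpDr (R : realType) p q (x y z : 'M[R]_(p, q)) :
  dotp z (x + y) = dotp z x + dotp z y.
Proof. by rewrite !(dotpC z) dotpDl. Qed.

Lemma dotpZr (R : realType) p q a (x z : 'M[R]_(p, q)) :
  dotp z (a *: x) = a * dotp z x.
Proof. by rewrite !(dotpC z) dotpZl. Qed.

Lemma dotpNl (R : realType) p q (x z : 'M[R]_(p, q)) :
  dotp (- x) z = - dotp x z.
Proof. by rewrite -scaleN1r dotpZl mulN1r. Qed.

Lemma dotpNr (R : realType) p q (x z : 'M[R]_(p, q)) :
  dotp z (- x) = - dotp z x.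
Proof. by rewrite !(dotpC z) dotpNl. Qed.

Lemma dotp0l (R : realType) p q (z : 'M[R]_(p, q)) : dotp 0 z = 0.
Proof. by rewrite -(scale0r z) dotpZl mul0r. Qed.

Definition dotpE := (dotpDl, dotpDr, dotpZl, dotpZr, dotpNl, dotpNr).

Lemma dotp_suml (R : realType) p q (J : finType) (P : pred J)
    (f : J -> 'M[R]_(p, q)) z :
  dotp (\sum_(i | P i) f i) z = \sum_(i | P i) dotp (f i) z.
Proof.
by elim/big_rec2: _ => [|i y1 y2 _ <-]; rewrite ?dotp0l// dotpDl.
Qed.

Lemma dotp_ge0 (R : realType) p q (x : 'M[R]_(p, q)) : 0 <= dotp x x.
Proof.
by apply: sumr_ge0 => i _; apply: sumr_ge0 => j _; rewrite -expr2 sqr_ge0.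
Qed.

Lemma enorm_sqr (R : realType) p q (x : 'M[R]_(p, q)) :
  enorm x ^+ 2 = dotp x x.
Proof. by rewrite sqr_sqrtr// dotp_ge0. Qed.

Lemma enorm_ge0 (R : realType) p q (x : 'M[R]_(p, q)) : 0 <= enorm x.
Proof. exact: sqrtr_ge0. Qed.

Lemma entry_le_norm (R : realType) p q (x : 'M[R]_(p, q)) i j :
  `|x i j| <= `|x|.
Proof.
by rewrite [leRHS]/Num.norm /= mx_normrE; apply/bigmax_geP; right; exists (i, j).
Qed.

Lemma norm_le_entry (R : realType) p q (x : 'M[R]_(p, q)) c : 0 <= c ->
  (forall i j, `|x i j| <= c) -> `|x| <= c.
Proof.
by move=> c0 xc; rewrite [leLHS]/Num.norm /= mx_normrE; apply/bigmax_leP.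
Qed.

Lemma entry_le_enorm (R : realType) p q (x : 'M[R]_(p, q)) i j :
  `|x i j| <= enorm x.
Proof.
rewrite -sqrtr_sqr ler_wsqrtr// /dotp (bigD1 i)//= (bigD1 j)//= -expr2 -addrA.
rewrite lerDl addr_ge0// ?sumr_ge0// => k _; first by rewrite -expr2 sqr_ge0.
by rewrite sumr_ge0// => l _; rewrite -expr2 sqr_ge0.
Qed.

Lemma norm_le_enorm (R : realType) p q (x : 'M[R]_(p, q)) : `|x| <= enorm x.
Proof.
by apply: norm_le_entry => [|i j]; [exact: enorm_ge0|exact: entry_le_enorm].
Qed.

Lemma enorm_gt0 (R : realType) p q (x : 'M[R]_(p, q)) : x != 0 -> 0 < enorm x.
Proof.
by move=> x0; apply: lt_le_trans (norm_le_enorm x); rewrite normr_gt0.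
Qed.

Lemma dotp_le_sqr (R : realType) p q (x : 'M[R]_(p, q)) :
  dotp x x <= (p * q)%:R * `|x| ^+ 2.
Proof.
apply: (@le_trans _ _ (\sum_(i < p) \sum_(j < q) `|x| ^+ 2)); last first.
  by rewrite !sumr_const !card_ord -mulrnA mulr_natl mulnC.
apply: ler_sum => i _; apply: ler_sum => j _.
by rewrite -expr2 -real_normK ?num_real// ler_sqr ?nnegrE// entry_le_norm.
Qed.

Lemma dotp_sqrD (R : realType) p q (x h : 'M[R]_(p, q)) :
  dotp (x + h) (x + h) = dotp x x + 2 * dotp x h + dotp h h.
Proof. by rewrite !dotpE (dotpC h x); ring. Qed.

Lemma dotp_eq0 (R : realType) p q (x : 'M[R]_(p, q)) : dotp x x = 0 -> x = 0.
Proof.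
move=> xx; apply/eqP; rewrite -normr_le0 (le_trans (norm_le_enorm _))//.
by rewrite /enorm xx sqrtr0.
Qed.

(** * Limits of matrix-valued functions *)

Lemma cvg_sumr (R : realType) (V : normedModType R) T (F : set_system T)
    (FF : Filter F) (J : finType) (P : pred J) (f : J -> T -> V) (a : J -> V) :
  (forall i, P i -> f i @ F --> a i) ->
  (\sum_(i | P i) f i t) @[t --> F] --> \sum_(i | P i) a i.
Proof.
move=> fa; elim: (index_enum J) => [|i s IH].
  by under eq_cvg do rewrite big_nil; rewrite big_nil; exact: cvg_cst.
under eq_cvg do rewrite big_cons; rewrite big_cons.
by case: ifPn => // Pi; apply: cvgD => //; exact: fa.
Qed.

Lemma cvg_matrix (R : realType) T (F : set_system T) (FF : Filter F) p q
    (f : T -> 'M[R]_(p, q)) (M : 'M[R]_(p, q)) :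
  (forall i j, f t i j @[t --> F] --> M i j) -> f @ F --> M.
Proof.
move=> fM; apply/cvgrPdist_le => e e0.
have H : \forall t \near F, forall ij : 'I_p * 'I_q, `|M ij.1 ij.2 - f t ij.1 ij.2| <= e.
  apply: filter_forall => -[i j] /=.
  by have /cvgrPdist_le := fM i j; apply.
apply: filterS H => t H; apply: norm_le_entry => [|i j]; first exact: ltW.
by have := H (i, j); rewrite !mxE.
Qed.

Lemma cvg_entry (R : realType) T (F : set_system T) (FF : Filter F) p q
    (f : T -> 'M[R]_(p, q)) (M : 'M[R]_(p, q)) i j :
  f @ F --> M -> f t i j @[t --> F] --> M i j.
Proof.
by move=> fM; apply: (cvg_comp f (fun N : 'M[R]_(p, q) => N i j) fM); exact: coord_continuous.
Qed.

Lemma cvg_dotp (R : realType) T (F : set_system T) (FF : Filter F) p q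
    (f g : T -> 'M[R]_(p, q)) (M N : 'M[R]_(p, q)) :
  f @ F --> M -> g @ F --> N -> dotp (f t) (g t) @[t --> F] --> dotp M N.
Proof.
move=> fM gN; apply: cvg_sumr => i _; apply: cvg_sumr => j _.
by apply: cvgM; exact: cvg_entry.
Qed.

Lemma cvg_enorm (R : realType) T (F : set_system T) (FF : Filter F) p q
    (f : T -> 'M[R]_(p, q)) (M : 'M[R]_(p, q)) :
  f @ F --> M -> enorm (f t) @[t --> F] --> enorm M.
Proof.
move=> fM; have fMM : dotp (f t) (f t) @[t --> F] --> dotp M M.
  exact: cvg_dotp.
by apply: cvg_comp fMM _; exact: sqrt_continuous.
Qed.

Lemma cvg_row (R : realType) T (F : set_system T) (FF : Filter F) p q
    (f : T -> 'M[R]_(p, q)) (M : 'M[R]_(p, q)) i :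
  f @ F --> M -> row i (f t) @[t --> F] --> row i M.
Proof.
move=> fM; apply: cvg_matrix => k j; rewrite mxE.
rewrite (_ : (fun t => _) = (fun t => f t i j)); first exact: cvg_entry.
by apply/funext => t; rewrite mxE.
Qed.

(** * Lipschitz functions *)

Lemma near_dist_le (R : realType) p q (x : 'M[R]_(p, q)) (e : R) : 0 < e ->
  \forall y \near x, `|y - x| <= e.
Proof.
move=> e0; apply/nbhs_ballP; exists e => //= y.
by rewrite mx_norm_ball /ball_ /= distrC => /ltW.
Qed.

Lemma klipschitz_continuous (R : realType) (V W : normedModType R) (f : V -> W)
    (L : R) :
  0 < L -> (forall x y, `|f x - f y| <= L * `|x - y|) -> continuous f.
Proof.
move=> L0 fL x; apply/cvgrPdist_le => e e0.
have eL : 0 < e / L by rewrite divr_gt0.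
apply: filterS (@nbhsx_ballx _ _ x _ eL) => y; rewrite -ball_normE /ball_ /=.
by rewrite ltr_pdivlMr// mulrC => /ltW; exact/le_trans.
Qed.

Lemma lipschitz_continuous (R : realType) (V W : normedModType R) (f : V -> W) :
  lipschitz f -> continuous f.
Proof.
move=> [M [Mr /(_ (`|M| + 1))]].
rewrite (le_lt_trans (ler_norm M)) ?ltrDl// => /(_ isT) fM.
apply: (@klipschitz_continuous _ _ _ _ (`|M| + 1)); first by rewrite ltr_wpDl.
by move=> x y; exact: (fM (x, y)).
Qed.

Lemma klipschitz_unif_continuous (R : realType) p q
    (w : 'M[R]_(p.+1, q.+1) -> R) (L : R) :
  0 < L -> (forall x y, `|w x - w y| <= L * `|x - y|) -> unif_continuous w.
Proof.
move=> L0 wL; apply/unif_continuousP => e e0.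
exists (e / L) => /=; first by rewrite divr_gt0.
move=> [x y] /=; rewrite mx_norm_ball /ball_ /= ltr_pdivlMr// mulrC => xy.
by rewrite -ball_normE /ball_ /= (le_lt_trans (wL _ _)).
Qed.

Lemma lipschitz_family (R : realType) (V : normedModType R) (J : finType)
    (f : J -> V -> R) : (forall i, lipschitz (f i)) ->
  exists2 L, 0 < L & forall i x y, `|f i x - f i y| <= L * `|x - y|.
Proof.
move=> fl.
have H : \forall M \near +oo, forall i, M.-lipschitz (f i).
  by apply: filter_forall => i; exact: fl.
have [M [/= Mr HM]] := H.
have M1 : M < `|M| + 1 by rewrite (le_lt_trans (ler_norm M)) ?ltrDl.
exists (`|M| + 1); first by rewrite ltr_wpDl.
by move=> i x y; exact: (HM _ M1 i (x, y)).
Qed.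

(** * Compactness through ultrafilters *)

(** Closed intervals are compact, and an ultrafilter converges to each of its
    cluster points.  One ultrafilter makes any number of bounded quantities
    converge together; this replaces product topologies and successive
    subsequences below. *)
Lemma ultra_bounded_cvg (R : realType) T (U : set_system T) (UU : UltraFilter U)
    (f : T -> R) (c : R) :
  (\forall t \near U, `|f t| <= c) -> exists a : R, f @ U --> a.
Proof.
move=> fc; have cc := @segment_compact R (- c) c.
have [|a [_ cla]] := cc (f @ U) _.
  by apply: filterS fc => t; rewrite /= in_itv/= ler_norml.
exists a => B Ba; have [//|UB] := in_ultra_setVsetC (f @^-1` B) UU.
by have [y [nBy /nBy]] := cla (~` B) B UB Ba.
Qed.

Lemma ultra_bounded_cvg_mx (R : realType) T (U : set_system T)
    (UU : UltraFilter U) p q (f : T -> 'M[R]_(p, q)) (x0 : 'M[R]_(p, q))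
    (c : R) :
  (\forall t \near U, `|f t - x0| <= c) ->
  exists2 a : 'M[R]_(p, q), f @ U --> a & `|a - x0| <= c.
Proof.
move=> fc.
have /choice[a fa] : forall k : 'I_p * 'I_q, exists a : R, f t k.1 k.2 @[t --> U] --> a.
  move=> k; apply: (@ultra_bounded_cvg _ _ _ UU _ (c + `|x0|)).
  apply: filterS fc => t ft; apply: (le_trans (entry_le_norm _ _ _)).
  by rewrite -[f t](subrK x0) (le_trans (ler_normD _ _))// lerD2r.
have fM : f @ U --> \matrix_(i, j) a (i, j).
  by apply: cvg_matrix => i j; rewrite mxE; exact: (fa (i, j)).
exists (\matrix_(i, j) a (i, j)) => //.
have fM' : `|f t - x0| @[t --> U] --> `|\matrix_(i, j) a (i, j) - x0|.
  by apply: cvg_norm; apply: cvgB => //; exact: cvg_cst.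
exact: cvgr_to_le fM' fc.
Qed.

(** The extreme value theorem without a topology on the domain: the sets where F
    is within e of its supremum generate a filter, and the limit along a finer
    ultrafilter is a maximizer. *)
Lemma ultra_sup_attained (R : realType) Z (D : set Z) (F : Z -> R) :
  D !=set0 -> has_ubound (F @` D) ->
  (forall U, UltraFilter U -> U D -> exists2 z, D z & F @ U --> F z) ->
  exists2 z, D z & forall z', D z' -> F z' <= F z.
Proof.
move=> D0 ubF ultraF; pose S := sup (F @` D).
have hsF : has_sup (F @` D) by split => //; exact: image_nonempty.
pose V := filter_from [set e : R | 0 < e] (fun e => [set z | D z /\ S - e < F z]).
have FV : ProperFilter V.
  apply: filter_from_proper => [|e /= e0].
    apply: filter_from_filter; first by exists 1 => /=.
    move=> e e' /= e0 e'0; exists (Num.min e e'); first by rewrite /= lt_min e0.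
    move=> z /= [Dz]; rewrite ltrBlDr => h.
    by split; split=> //; rewrite ltrBlDr (lt_le_trans h)// lerD2l ge_min lexx ?orbT.
  have [_ [z Dz <-] Sz] := sup_adherent e0 hsF.
  by exists z.
have [U [UU VU]] := ultraFilterLemma FV.
have UD : U D by apply: VU; exists 1 => //= z [].
have [z Dz Fz] := ultraF _ UU UD; exists z => // z' Dz'.
apply: (@le_trans _ _ S); first by apply: sup_upper_bound => //; exact: imageP.
apply/ler_addgt0Pr => e e0; rewrite -lerBlDr.
have US : U [set z | S - e <= F z].
  by apply: VU; exists e => // y [_ /ltW].
exact: cvgr_to_ge Fz US.
Qed.

(** * The penalized problem *)

Definition pospart (R : realType) (z : R) : R := Num.max z 0.

Lemma pospart_ge0 (R : realType) (z : R) : 0 <= pospart z.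
Proof. by rewrite /pospart le_max lexx orbT. Qed.

Lemma pospart_ge (R : realType) (z : R) : z <= pospart z.
Proof. by rewrite /pospart le_max lexx. Qed.

(** The squared positive part has the 2-Lipschitz derivative 2 z^+; this is the
    corresponding second order upper bound. *)
Lemma pospart_sqrD (R : realType) (z h : R) :
  pospart (z + h) ^+ 2 <= pospart z ^+ 2 + 2 * pospart z * h + h ^+ 2.
Proof. by rewrite /pospart; case: (leP z 0); case: (leP (z + h) 0); nra. Qed.

Lemma cvg_pospart (R : realType) T (F : set_system T) (FF : Filter F)
    (f : T -> R) (a : R) :
  f @ F --> a -> pospart (f t) @[t --> F] --> pospart a.
Proof.
move=> fa; rewrite /pospart maxr_absE.
under eq_cvg do rewrite maxr_absE.
apply: cvgMr_tmp; apply: cvgD; first by apply: cvgD => //; exact: cvg_cst.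
by apply: cvg_norm; apply: cvgB => //; exact: cvg_cst.
Qed.

(** Stationarity at a minimum, stated with a quadratic error term so that no
    derivative has to be computed. *)
Lemma critical_point (R : realType) (a C d : R) : 0 < d ->
  (forall s, `|s| <= d -> 0 <= a * s + C * s ^+ 2) -> a = 0.
Proof.
move=> d0 h; apply/eqP/negPn/negP => a0.
have a1 : 0 < `|a| by rewrite normr_gt0.
pose C' := `|C| + 1.
have C'0 : 0 < C' by rewrite /C' ltr_wpDl.
have CC' : C <= C' by rewrite /C' (le_trans (ler_norm _))// lerDl.
(* the step s = - tau a makes a s + C s^2 at most - tau a^2 / 2 *)
pose tau := Num.min (d / `|a|) (2 * C')^-1.
have tau0 : 0 < tau by rewrite /tau lt_min divr_gt0//= invr_gt0 mulr_gt0.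
have td : tau * `|a| <= d by rewrite -ler_pdivlMr// /tau ge_min lexx.
have tC : C' * tau <= 1 / 2.
  rewrite -ler_pdivlMl// mul1r -invfM mulrC.
  by rewrite /tau ge_min lexx orbT.
have := h (- tau * a); rewrite normrM normrN (gtr0_norm tau0) => /(_ td).
have a2 : 0 < a ^+ 2 by rewrite exprn_even_gt0.
have : C * tau <= 1 / 2 by apply: le_trans tC; rewrite ler_wpM2r// ltW.
move=> Ct; rewrite (_ : _ + _ = tau * a ^+ 2 * (C * tau - 1)); last by ring.
by rewrite (pmulr_rge0 _ (mulr_gt0 tau0 a2)) => ?; lra.
Qed.

(** A quadratic function with gradient P at x touches w at x from above: P is a
    proximal supergradient of w at x. *)
Definition quad_touch (R : realType) p q (w : 'M[R]_(p.+1, q.+1) -> R)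
    (x P : 'M[R]_(p.+1, q.+1)) : Prop :=
  exists C : R, \forall y \near x,
    w y <= w x + dotp P (y - x) + C * dotp (y - x) (y - x).

(** The variable z = ((X, y), t) consists of one point X i for each function
    w i, a common point y near all of them, and a level t.  As K and A grow, the
    penalties enforce t <= w i (X i) - phi y and X i = y, so that maximizing t
    amounts to maximizing the minimum of the functions w i - phi. *)
Definition penalized (R : realType) (J : finType) (I : {set J}) p q
    (w : J -> 'M[R]_(p.+1, q.+1) -> R) (phi : 'M[R]_(p.+1, q.+1) -> R) (K A : R)
    (z : (J -> 'M[R]_(p.+1, q.+1)) * 'M[R]_(p.+1, q.+1) * R) : R :=
  z.2 - K * \sum_(i in I) pospart (z.2 - w i (z.1.1 i) + phi z.1.2) ^+ 2
      - A * \sum_(i in I) dotp (z.1.1 i - z.1.2) (z.1.1 i - z.1.2).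

(** The points X i move in a ball twice as large as the ball for y, so that X i
    is interior as soon as it is closer than rho to y.  The lower bound on t is
    there for compactness; where the functional is nonnegative, t >= 0. *)
Definition penalized_dom (R : realType) (J : finType) p q
    (x0 : 'M[R]_(p.+1, q.+1)) (rho c : R)
    : set ((J -> 'M[R]_(p.+1, q.+1)) * 'M[R]_(p.+1, q.+1) * R) :=
  [set z | [/\ forall i, `|z.1.1 i - x0| <= 2 * rho, `|z.1.2 - x0| <= rho
             & -1 <= z.2 <= c]].

Lemma penalized_max (R : realType) (J : finType) (I : {set J}) p q
    (w : J -> 'M[R]_(p.+1, q.+1) -> R) (phi : 'M[R]_(p.+1, q.+1) -> R) (K A : R)
    x0 rho c : 0 <= K -> 0 <= A -> 0 <= rho -> 0 <= c ->
  (forall i, continuous (w i)) -> continuous phi ->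
  exists2 z, penalized_dom x0 rho c z &
    forall z', penalized_dom x0 rho c z' ->
      penalized I w phi K A z' <= penalized I w phi K A z.
Proof.
move=> K0 A0 r0 c0 wc phic.
apply: ultra_sup_attained.
- exists (fun=> x0, x0, 0); split => /=.
  + by move=> i; rewrite subrr normr0 mulr_ge0.
  + by rewrite subrr normr0.
  + by rewrite c0 andbT oppr_le0.
- exists c => _ [z [_ _ /andP[_ zc]] <-]; rewrite /penalized.
  rewrite -addrA -opprD lerBlDr (le_trans zc)// lerDl addr_ge0// mulr_ge0//.
    by apply: sumr_ge0 => i _; rewrite sqr_ge0.
  by apply: sumr_ge0 => i _; exact: dotp_ge0.
move=> U UU UD.
have /choice[X UX] : forall i, exists a : 'M[R]_(p.+1, q.+1),
    z.1.1 i @[z --> U] --> a /\ `|a - x0| <= 2 * rho.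
  move=> i; have [|a ? ?] := @ultra_bounded_cvg_mx R _ U UU _ _
    (fun z => z.1.1 i) x0 (2 * rho); last by exists a.
  by apply: filterS UD => z [].
have [|y Uy yr] := @ultra_bounded_cvg_mx R _ U UU _ _ (fun z => z.1.2) x0 rho.
  by apply: filterS UD => z [].
have [|t Ut] := @ultra_bounded_cvg R _ U UU snd (c + 1).
  apply: filterS UD => z [_ _ /andP[? ?]].
  by rewrite ler_norml; apply/andP; split; lra.
exists (X, y, t).
  split => /=; [by move=> i; have [] := UX i | exact: yr | apply/andP; split].
    by apply: cvgr_to_ge Ut _; apply: filterS UD => z [_ _ /andP[]].
  by apply: cvgr_to_le Ut _; apply: filterS UD => z [_ _ /andP[]].
have Uw i : w i (z.1.1 i) @[z --> U] --> w i (X i).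
  by apply: (cvg_comp (fun z => z.1.1 i) (w i)); [exact: (UX i).1|exact: wc].
have Uphi : phi z.1.2 @[z --> U] --> phi y.
  by apply: (cvg_comp (fun z => z.1.2) phi); [exact: Uy|exact: phic].
rewrite /penalized; apply: cvgB; [apply: cvgB => //|]; apply: cvgM.
- exact: cvg_cst.
- apply: cvg_sumr => i _; rewrite expr2; under eq_cvg do rewrite expr2.
  by apply: cvgM; apply: cvg_pospart; apply: cvgD => //; apply: cvgB.
- exact: cvg_cst.
- by apply: cvg_sumr => i _; apply: cvg_dotp; apply: cvgB => //; exact: (UX i).1.
Qed.

Definition penalized_maximizer (R : realType) (J : finType) (I : {set J}) p q
    (w : J -> 'M[R]_(p.+1, q.+1) -> R) phi (K A : R) x0 rho c z : Prop :=
  penalized_dom x0 rho c z /\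
  forall z', penalized_dom x0 rho c z' ->
    penalized I w phi K A z' <= penalized I w phi K A z.

(** The derivative with respect to t of the i-th term of the first penalty. *)
Definition weight (R : realType) (J : Type) p q
    (w : J -> 'M[R]_(p.+1, q.+1) -> R) (phi : 'M[R]_(p.+1, q.+1) -> R) (K : R)
    (z : (J -> 'M[R]_(p.+1, q.+1)) * 'M[R]_(p.+1, q.+1) * R) (i : J) : R :=
  2 * K * pospart (z.2 - w i (z.1.1 i) + phi z.1.2).

(** Stationarity in t. *)
Lemma weight_sum1 (R : realType) (J : finType) (I : {set J}) p q
    (w : J -> 'M[R]_(p.+1, q.+1) -> R) phi (K A : R) x0 rho c z :
  0 <= K -> penalized_maximizer I w phi K A x0 rho c z -> -1 < z.2 < c ->
  \sum_(i in I) weight w phi K z i = 1.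
Proof.
move=> K0 [[zX zy zt] zmax] /andP[t1 tc].
apply/eqP; rewrite -subr_eq0; apply/eqP.
apply: (@critical_point R _ (K * \sum_(i in I) 1) (Num.min (z.2 + 1) (c - z.2))).
  by rewrite lt_min; apply/andP; split; lra.
move=> s; rewrite le_min !ler_norml => /andP[/andP[s1 _] /andP[_ s2]].
have /zmax : penalized_dom x0 rho c (z.1, z.2 + s).
  by split => //=; apply/andP; split; lra.
rewrite /penalized /= lerD2r => H.
have : \sum_(i in I) pospart (z.2 + s - w i (z.1.1 i) + phi z.1.2) ^+ 2 <=
  \sum_(i in I) (pospart (z.2 - w i (z.1.1 i) + phi z.1.2) ^+ 2
    + 2 * pospart (z.2 - w i (z.1.1 i) + phi z.1.2) * s + s ^+ 2).
  apply: ler_sum => i _; apply: le_trans (pospart_sqrD _ _).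
  by rewrite le_eqVlt; apply/orP; left; apply/eqP; congr (pospart _ ^+ 2); ring.
move/(ler_wpM2l K0); rewrite !big_split/= !mulrDr => H2.
suff -> : (\sum_(i in I) weight w phi K z i - 1) * s + K * (\sum_(i in I) 1) * s ^+ 2
  = K * (\sum_(i in I) 2 * pospart (z.2 - w i (z.1.1 i) + phi z.1.2) * s)
    + K * (\sum_(i in I) s ^+ 2) - s by lra.
rewrite mulrBl mul1r addrAC; congr (_ + _ - _).
  rewrite mulr_suml mulr_sumr; apply: eq_bigr => i _; rewrite /weight; ring.
by rewrite -mulrA mulr_suml; congr (K * _); apply: eq_bigr => i _; rewrite mul1r.
Qed.

(** Maximality in X i.  The increment of w i enters the penalty to first order
    with the factor [weight] and to second order with the factor K; as w i is
    Lipschitz, the second order part is at most K L^2 |h|^2. *)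
Lemma weight_touch (R : realType) (J : finType) (I : {set J}) p q
    (w : J -> 'M[R]_(p.+1, q.+1) -> R) phi (L K A : R) x0 rho c z i :
  0 <= K -> (forall x y, `|w i x - w i y| <= L * `|x - y|) ->
  penalized_maximizer I w phi K A x0 rho c z ->
  i \in I -> `|z.1.1 i - x0| < 2 * rho ->
  exists2 d, 0 < d & forall h, `|h| <= d ->
    weight w phi K z i * (w i (z.1.1 i + h) - w i (z.1.1 i)) <=
    2 * A * dotp (z.1.1 i - z.1.2) h + (K * L ^+ 2 + A) * dotp h h.
Proof.
move=> K0 wL [[zX zy zt] zmax] iI Xi; exists (2 * rho - `|z.1.1 i - x0|).
  by rewrite subr_gt0.
move=> h hd.
pose X k := if k == i then z.1.1 i + h else z.1.1 k.
have /zmax : penalized_dom x0 rho c (X, z.1.2, z.2).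
  split => //= k; rewrite /X; case: ifP => // _.
  by rewrite addrAC (le_trans (ler_normD _ _))// -lerBrDl.
rewrite /penalized /= !(bigD1 i iI)/=.
under eq_bigr => k /andP[_ /negbTE ki] do rewrite /X ki.
under [X in _ - _ - _ * (_ + X)]eq_bigr => k /andP[_ /negbTE ki] do rewrite /X ki.
rewrite /X eqxx.
set S1 := \sum_(_ | _) _ ^+ 2; set S2 := \sum_(_ | _) dotp _ _.
set f := z.2 - w i (z.1.1 i) + phi z.1.2.
set om := w i (z.1.1 i + h) - w i (z.1.1 i).
rewrite (_ : _ + phi z.1.2 = f + - om); last by rewrite /f /om; ring.
rewrite (_ : z.1.1 i + h - z.1.2 = (z.1.1 i - z.1.2) + h); last by rewrite addrAC.
rewrite dotp_sqrD => H.
have := ler_wpM2l K0 (pospart_sqrD f (- om)).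
have om2 : om ^+ 2 <= L ^+ 2 * dotp h h.
  have omh : `|om| <= L * `|h|.
    by have := wL (z.1.1 i + h) (z.1.1 i); rewrite [_ + h - _]addrAC subrr add0r.
  rewrite -real_normK ?num_real//; apply: (@le_trans _ _ ((L * `|h|) ^+ 2)).
    by rewrite ler_sqr ?nnegrE// (le_trans _ omh).
  rewrite exprMn ler_wpM2l ?sqr_ge0// -enorm_sqr.
  by rewrite ler_sqr ?nnegrE ?enorm_ge0// norm_le_enorm.
have := ler_wpM2l K0 om2.
rewrite /weight -/f -/om.
by move: H; set a := dotp _ h; set b := dotp h h; lra.
Qed.

(** The test function in y is quadratic so that its expansion is exact. *)
Definition quadratic (R : realType) p q (x0 g : 'M[R]_(p, q)) (v0 kap : R)
    (y : 'M[R]_(p, q)) : R :=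
  v0 + dotp g (y - x0) + kap * dotp (y - x0) (y - x0).

Lemma quadraticD (R : realType) p q (x0 g : 'M[R]_(p, q)) v0 kap y h :
  quadratic x0 g v0 kap (y + h) = quadratic x0 g v0 kap y
    + dotp (g + (2 * kap) *: (y - x0)) h + kap * dotp h h.
Proof.
rewrite /quadratic (_ : y + h - x0 = (y - x0) + h); last by rewrite addrAC.
by rewrite dotp_sqrD dotpDr (dotpDl g) dotpZl; ring.
Qed.

(** Stationarity in y, tested in the direction G of the difference of the two
    sides: the first order term is then s |G|^2. *)
Lemma weight_barycenter (R : realType) (J : finType) (I : {set J}) p q
    (w : J -> 'M[R]_(p.+1, q.+1) -> R) x0 g v0 kap (K A : R) rho c z :
  0 <= K ->
  penalized_maximizer I w (quadratic x0 g v0 kap) K A x0 rho c z ->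
  \sum_(i in I) weight w (quadratic x0 g v0 kap) K z i = 1 ->
  `|z.1.2 - x0| < rho ->
  \sum_(i in I) (2 * A) *: (z.1.1 i - z.1.2) = g + (2 * kap) *: (z.1.2 - x0).
Proof.
move=> K0 [[zX zy zt] zmax] w1 yr; set phi := quadratic _ _ _ _ in zmax w1 *.
set y := z.1.2 in zy yr *.
apply/esym/eqP; rewrite -subr_eq0; apply/eqP.
set v := g + _; set b := \sum_(i in I) _; set G := v - b.
apply: dotp_eq0.
set al := dotp v G; set be := kap * dotp G G; set k : R := \sum_(i in I) 1.
have k0 : 0 <= k by apply: sumr_ge0.
pose d := Num.min 1 ((rho - `|y - x0|) / (`|G| + 1)).
have G1 : 0 < `|G| + 1 by rewrite ltr_wpDl.
have d0 : 0 < d by rewrite lt_min ltr01/= divr_gt0// subr_gt0.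
apply: (@critical_point R _ (be + K * k * (`|al| + `|be|) ^+ 2 + A * k * dotp G G) d) => //.
move=> s; rewrite le_min => /andP[s1 s2].
have /zmax : penalized_dom x0 rho c (z.1.1, y + s *: G, z.2).
  split => //=; rewrite addrAC (le_trans (ler_normD _ _))// -lerBrDl normrZ.
  rewrite ler_pdivlMr// in s2.
  by apply: le_trans s2; rewrite ler_wpM2l// lerDl.
set th := s * al + s ^+ 2 * be.
have phiE : phi (y + s *: G) = phi y + th.
  by rewrite /phi quadraticD -/v !dotpZr dotpZl /th /al /be; ring.
rewrite /penalized /= -/y phiE => H.
have : \sum_(i in I) pospart (z.2 - w i (z.1.1 i) + (phi y + th)) ^+ 2 <=
  \sum_(i in I) (pospart (z.2 - w i (z.1.1 i) + phi y) ^+ 2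
    + 2 * pospart (z.2 - w i (z.1.1 i) + phi y) * th + th ^+ 2).
  by apply: ler_sum => i _; rewrite addrA pospart_sqrD.
move/(ler_wpM2l K0); rewrite !big_split/= !mulrDr => H2.
have E1 : K * (\sum_(i in I) 2 * pospart (z.2 - w i (z.1.1 i) + phi y) * th) = th.
  transitivity ((\sum_(i in I) weight w phi K z i) * th); last by rewrite w1 mul1r.
  rewrite mulr_suml mulr_sumr.
  by apply: eq_bigr => i _; rewrite /weight -/y; ring.
have E2 : \sum_(i in I) th ^+ 2 = k * th ^+ 2.
  by rewrite /k mulr_suml; apply: eq_bigr => i _; rewrite mul1r.
have E3 : A * \sum_(i in I) dotp (z.1.1 i - (y + s *: G)) (z.1.1 i - (y + s *: G))
  = A * (\sum_(i in I) dotp (z.1.1 i - y) (z.1.1 i - y)) - s * dotp b G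
    + A * k * s ^+ 2 * dotp G G.
  have bG : dotp b G = 2 * A * \sum_(i in I) dotp (z.1.1 i - y) G.
    by rewrite /b dotp_suml mulr_sumr; apply: eq_bigr => i _; rewrite dotpZl.
  have kG : k * (s ^+ 2 * dotp G G) = \sum_(i in I) s ^+ 2 * dotp G G.
    by rewrite /k mulr_suml; apply: eq_bigr => i _; rewrite mul1r.
  have -> : \sum_(i in I) dotp (z.1.1 i - (y + s *: G)) (z.1.1 i - (y + s *: G))
    = \sum_(i in I) dotp (z.1.1 i - y) (z.1.1 i - y)
      - 2 * s * (\sum_(i in I) dotp (z.1.1 i - y) G) + k * (s ^+ 2 * dotp G G).
    rewrite kG mulr_sumr -sumrB -big_split; apply: eq_bigr => i _ /=.
    by rewrite opprD addrA -scaleNr (dotp_sqrD (z.1.1 i - y)) !dotpZr dotpZl; ring.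
  by rewrite bG; ring.
have th2 : th ^+ 2 <= s ^+ 2 * (`|al| + `|be|) ^+ 2.
  rewrite (_ : th = s * (al + s * be)); last by rewrite /th; ring.
  rewrite exprMn ler_wpM2l ?sqr_ge0// -[leLHS]real_normK ?num_real//.
  rewrite ler_sqr ?nnegrE ?addr_ge0// (le_trans (ler_normD _ _))// lerD2l.
  by rewrite normrM ler_piMl.
have := ler_wpM2l (mulr_ge0 K0 k0) th2.
have GG : dotp G G = al - dotp b G by rewrite {1}/G dotpDl dotpNl.
have thE : th = s * al + s ^+ 2 * be by [].
rewrite E3 in H; rewrite E1 E2 in H2.
rewrite [X in X * s]GG => H3.
clearbody th k al be G b; lra.
Qed.

(** Points where the functional is nonnegative are interior.  Take an index i that
    realizes the minimum at y, and put s = |y - x0|, d = |X i - y|.  The argument z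
    of the i-th penalty is at least t - eta s + kap s^2 - L d, and nonnegativity
    gives K (z^+)^2 + A d^2 <= t.  Since K (z^+)^2 >= z - 1/(4K), this implies
      0 <= eta s - kap s^2 + L d - A d^2 + 1/(4K)
        <= eta s - kap s^2 + L^2/(4A) + 1/(4K).
    As kap = 2 eta / rho, the first two terms are at most - eta rho when s >= rho,
    and the others are too small to compensate.  The same computation with
    K (z^+)^2 >= 2 z - 1/K gives t < c, and then A |X k - y|^2 <= t puts every X k
    close to y.  The number c = eta rho is the common scale of all the terms. *)
Lemma penalized_interior (R : realType) (J : finType) (I : {set J}) p q
    (w : J -> 'M[R]_(p.+1, q.+1) -> R) (L eta rho kap K A c : R) x0 v0 g z :
  (forall i x y, `|w i x - w i y| <= L * `|x - y|) ->
  0 < L -> 0 < eta -> 0 < rho ->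
  c = eta * rho -> kap * rho = 2 * eta -> K * c = 4 ->
  A * c = 4 * L ^+ 2 + 2 * eta ^+ 2 ->
  (forall x, `|x - x0| <= rho -> exists2 i, i \in I &
     w i x <= v0 + dotp g (x - x0) + eta * enorm (x - x0)) ->
  penalized_dom x0 rho c z ->
  0 <= penalized I w (quadratic x0 g v0 kap) K A z ->
  [/\ `|z.1.2 - x0| < rho, -1 < z.2 < c
    & forall i, i \in I -> `|z.1.1 i - z.1.2| < rho].
Proof.
move=> wL L0 e0 r0 cE kapE KE AE wI [zX zy /andP[zt1 zt2]].
have c0 : 0 < c by rewrite cE mulr_gt0.
have K0 : 0 < K by rewrite -(pmulr_lgt0 _ c0) KE.
have A0 : 0 < A.
  by rewrite -(pmulr_lgt0 _ c0) AE addr_gt0// mulr_gt0// exprn_gt0.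
have kap0 : 0 < kap by rewrite -(pmulr_lgt0 _ r0) kapE mulr_gt0.
case: z => [[X y] t] in zX zy zt1 zt2 * => /=.
rewrite /penalized /= in zX zy zt1 zt2 * => H.
set phi := quadratic _ _ _ _ in H.
pose f i := t - w i (X i) + phi y.
pose d i := enorm (X i - y).
have H' i : i \in I -> K * pospart (f i) ^+ 2 + A * d i ^+ 2 <= t.
  move=> iI; move: H; rewrite !(bigD1 i iI)/= -/(f i) -enorm_sqr -/(d i).
  set S1 := \sum_(_ | _) _ ^+ 2; set S2 := \sum_(_ | _) dotp _ _ => H.
  have S10 : 0 <= S1 by apply: sumr_ge0 => k _; rewrite sqr_ge0.
  have S20 : 0 <= S2 by apply: sumr_ge0 => k _; exact: dotp_ge0.
  have := mulr_ge0 (ltW K0) S10; have := mulr_ge0 (ltW A0) S20; lra.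
have [i iI wi] := wI y zy.
pose s := enorm (y - x0).
have s0 : 0 <= s := enorm_ge0 _.
have fi : t - eta * s - L * d i + kap * s ^+ 2 <= f i.
  rewrite /f /phi /quadratic -enorm_sqr -/s.
  have wXi : w i (X i) - w i y <= L * d i.
    rewrite (le_trans (ler_norm _))// (le_trans (wL i (X i) y))//.
    by apply: ler_wpM2l; [exact: ltW|exact: norm_le_enorm].
  by rewrite -/s in wi; lra.
have d0 : 0 <= d i := enorm_ge0 _.
have pf := pospart_ge (f i).
have Ht := H' i iI.
(* Completed squares: P1 and P2 in the penalty, Q1 and Q2 in d, S1 in s.  The
   versions with a factor 2 bound t, the others locate y. *)
have P1 : 2 * pospart (f i) - c / 4 <= K * pospart (f i) ^+ 2.
  rewrite -(ler_pM2l K0) -subr_ge0.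
  rewrite (_ : _ - _ = (K * pospart (f i) - 1) ^+ 2 + (K * c - 4) / 4); last by field.
  by rewrite KE subrr mul0r addr0 sqr_ge0.
have P2 : pospart (f i) - c / 16 <= K * pospart (f i) ^+ 2.
  rewrite -(ler_pM2l K0) -subr_ge0.
  rewrite (_ : _ - _ = (K * pospart (f i) - 1 / 2) ^+ 2 + (K * c - 4) / 16); last by field.
  by rewrite KE subrr mul0r addr0 sqr_ge0.
have Q1 : 2 * (L * d i) - A * d i ^+ 2 <= c / 4.
  rewrite -(ler_pM2l A0) -subr_ge0.
  rewrite (_ : _ - _ = (A * d i - L) ^+ 2 + (A * c - 4 * L ^+ 2) / 4); last by field.
  by rewrite AE addrAC subrr add0r addr_ge0 ?sqr_ge0// divr_ge0// mulr_ge0// sqr_ge0.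
have Q2 : L * d i - A * d i ^+ 2 <= c / 16.
  rewrite -(ler_pM2l A0) -subr_ge0.
  rewrite (_ : _ - _ = (A * d i - L / 2) ^+ 2 + (A * c - 4 * L ^+ 2) / 16); last by field.
  by rewrite AE addrAC subrr add0r addr_ge0 ?sqr_ge0// divr_ge0// mulr_ge0// sqr_ge0.
have S1 : 2 * eta * s - 2 * kap * s ^+ 2 <= c / 4.
  rewrite -(ler_pM2l kap0) -subr_ge0.
  rewrite (_ : _ - _ = 2 * (kap * s - eta / 2) ^+ 2 + (kap * c - 2 * eta ^+ 2) / 4); last by field.
  rewrite (_ : kap * c = 2 * eta ^+ 2); last by rewrite cE mulrCA kapE; ring.
  by rewrite subrr mul0r addr0 mulr_ge0// sqr_ge0.
have tc : t <= 3 / 4 * c by lra.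
split.
- rewrite lt_neqAle zy andbT; apply/eqP => yr.
  have rs : rho <= s by rewrite -yr norm_le_enorm.
  have : eta * s - kap * s ^+ 2 <= - c.
    have k1 : 2 * eta <= kap * s by rewrite -kapE ler_wpM2l// ltW.
    have k2 : c <= eta * s by rewrite cE ler_wpM2l// ltW.
    have := ler_wpM2r s0 k1; lra.
  lra.
- have t0 : 0 <= t.
    by apply: le_trans Ht; rewrite addr_ge0// mulr_ge0 ?sqr_ge0// ltW.
  by apply/andP; split; lra.
- move=> k kI; rewrite (le_lt_trans (norm_le_enorm _))//.
  rewrite -/(d k) ltNge; apply/negP => rd.
  have := H' k kI; have : 0 <= K * pospart (f k) ^+ 2.
    by rewrite mulr_ge0 ?sqr_ge0// ltW.
  have : A * rho ^+ 2 <= A * d k ^+ 2.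
    by rewrite ler_pM2l// ler_sqr ?nnegrE// ?(le_trans _ rd)// ltW.
  have : 2 * c <= A * rho ^+ 2.
    rewrite -(ler_pM2r c0) [leRHS]mulrAC AE.
    have : 0 <= 4 * L ^+ 2 * rho ^+ 2 by rewrite -mulrA -exprMn mulr_ge0 ?sqr_ge0.
    rewrite cE; lra.
  lra.
Qed.

(** * The approximate rule for the superdifferential of a minimum *)

(** The hypothesis is a first order upper bound of the minimum up to the cone
    eta |x - x0|.  The concave perturbation - kap |x - x0|^2 with
    kap = 2 eta / rho dominates this cone on the boundary of the ball of radius
    rho, while its gradient in the ball is at most 4 eta, whence the error in the
    conclusion.  Where lam i = 0 no touching is claimed: stationarity only says
    that X i = y. *)
Lemma fuzzy_min_rule (R : realType) (J : finType) (I : {set J}) p q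
    (w : J -> 'M[R]_(p.+1, q.+1) -> R) (L eta rho : R) x0 v0 g :
  (forall i x y, `|w i x - w i y| <= L * `|x - y|) ->
  0 < L -> 0 < eta -> 0 < rho -> (forall i, i \in I -> v0 <= w i x0) ->
  (forall x, `|x - x0| <= rho -> exists2 i, i \in I &
     w i x <= v0 + dotp g (x - x0) + eta * enorm (x - x0)) ->
  exists (X : J -> 'M[R]_(p.+1, q.+1)) (lam : J -> R)
    (P : J -> 'M[R]_(p.+1, q.+1)),
  [/\ forall i, `|X i - x0| <= 2 * rho,
      forall i, 0 <= lam i, \sum_(i in I) lam i = 1,
      forall i, i \in I -> 0 < lam i -> quad_touch (w i) (X i) (P i)
    & `|\sum_(i in I) lam i *: P i - g| <= 4 * eta].
Proof.
move=> wL L0 e0 r0 w0 wI.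
(* K, A and kap solve the equations required by [penalized_interior] *)
pose c := eta * rho; pose kap := 2 * eta / rho; pose K := 4 / c.
pose A := (4 * L ^+ 2 + 2 * eta ^+ 2) / c.
have c0 : 0 < c by rewrite mulr_gt0.
have kapE : kap * rho = 2 * eta by rewrite /kap mulfVK// gt_eqF.
have KE : K * c = 4 by rewrite /K mulfVK// gt_eqF.
have AE : A * c = 4 * L ^+ 2 + 2 * eta ^+ 2 by rewrite /A mulfVK// gt_eqF.
have K0 : 0 <= K by rewrite divr_ge0// ltW.
have A0 : 0 <= A.
  by rewrite divr_ge0 ?(ltW c0)// addr_ge0// mulr_ge0// sqr_ge0.
pose phi := quadratic x0 g v0 kap.
have wc i : continuous (w i) := klipschitz_continuous L0 (wL i).
have phic : continuous phi.
  move=> x; rewrite /phi /quadratic; have FF : Filter (nbhs x) := nbhs_filter x.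
  have xx : (fun y => y - x0) @ nbhs x --> x - x0.
    by apply: (cvgB (F := nbhs x)); [exact: (@cvg_id _ (nbhs x))|exact: cvg_cst].
  apply: cvgD; last by apply: cvgM; [exact: cvg_cst|exact: cvg_dotp].
  by apply: cvgD; [exact: cvg_cst|apply: cvg_dotp => //; exact: cvg_cst].
have [z zdom zmax] := @penalized_max R J I p q w phi K A x0 rho c
  K0 A0 (ltW r0) (ltW c0) wc phic.
have zM : penalized_maximizer I w phi K A x0 rho c z by split.
(* the functional vanishes at X = y = x0, t = 0 *)
have z0 : 0 <= penalized I w phi K A z.
  have dom0 : penalized_dom x0 rho c ((fun=> x0) : J -> _, x0, 0).
    split => [i||] /=; rewrite ?subrr ?normr0 ?(ltW r0)//.
      by rewrite mulr_ge0// ltW.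
    by rewrite (ltW c0) andbT oppr_le0.
  apply: le_trans (zmax _ dom0); rewrite /penalized /=.
  rewrite [X in _ - A * X]big1 => [|i _]; last by rewrite subrr dotp0l.
  rewrite [X in _ - K * X]big1 => [|i iI]; first by rewrite !mulr0 !subr0.
  rewrite /phi /quadratic subrr dotp0l mulr0 dotpC dotp0l !addr0 sub0r addrC.
  by rewrite /pospart max_r ?expr0n//= subr_le0 w0.
have [yr tc Xr] := penalized_interior wL L0 e0 r0 erefl kapE KE AE wI zdom z0.
have lam1 := weight_sum1 K0 zM tc.
have bary := weight_barycenter K0 zM lam1 yr.
pose lam := weight w phi K z.
have lam0 i : 0 <= lam i by apply: mulr_ge0; [exact: mulr_ge0|exact: pospart_ge0].
exists z.1.1, lam, (fun i => (lam i)^-1 *: ((2 * A) *: (z.1.1 i - z.1.2))).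
have Xi i : i \in I -> `|z.1.1 i - x0| < 2 * rho.
  move=> iI; rewrite -(subrK z.1.2 (z.1.1 i)) -addrA (le_lt_trans (ler_normD _ _))//.
  by rewrite mulr_natl mulr2n ltrD// Xr.
split => //.
- by case: zdom.
- move=> i iI li.
  have [d d0 hd] := weight_touch K0 (wL i) zM iI (Xi i iI).
  exists ((lam i)^-1 * (K * L ^+ 2 + A)).
  apply: (@filterS _ (nbhs (z.1.1 i)) _ _ _ _ (near_dist_le (z.1.1 i) d0)) => y hy.
  have := hd _ hy; rewrite (addrC (z.1.1 i)) subrK -/(lam i) -ler_pdivlMl// mulrDr lerBlDl.
  by rewrite addrA !dotpZl (mulrA _ (K * L ^+ 2 + A)).
- have close (S : 'M[R]_(p.+1, q.+1)) : S = g + (2 * kap) *: (z.1.2 - x0) -> `|S - g| <= 4 * eta.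
    move=> ->; rewrite addrC addKr normrZ ger0_norm; last first.
      by rewrite !mulr_ge0 ?invr_ge0// ltW.
    rewrite (_ : 4 * eta = 2 * kap * rho); last by rewrite -mulrA kapE; ring.
    by rewrite ler_wpM2l ?(ltW yr)// !mulr_ge0 ?invr_ge0// ltW.
  apply: close; rewrite -bary; apply: eq_bigr => i iI.
  have [l0|l0] := eqVneq (lam i) 0; last by rewrite scalerA divff// scale1r.
  rewrite l0 scale0r; apply/esym.
  have [d d0 hd] := weight_touch K0 (wL i) zM iI (Xi i iI).
  set v := (2 * A) *: _; apply: dotp_eq0.
  apply: (@critical_point R _ ((K * L ^+ 2 + A) * dotp v v) (d / (`|v| + 1))).
    by rewrite divr_gt0// ltr_wpDl.
  move=> s; rewrite ler_pdivlMr ?ltr_wpDl// => sd.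
  have : `|s *: v| <= d.
    by rewrite normrZ; apply: le_trans sd; rewrite ler_wpM2l// lerDl.
  move=> /hd; rewrite -/lam -/(lam i) l0 mul0r !dotpZr dotpZl.
  by rewrite {2}/v dotpZl; lra.
Qed.

(** * Quadratic touching and superdifferentials *)

Lemma dotp_is_linear (R : realType) p q (g : 'M[R]_(p, q)) :
  linear_for *%R (dotp g).
Proof. by move=> a x y; rewrite dotpDr dotpZr. Qed.

HB.instance Definition _ (R : realType) p q (g : 'M[R]_(p, q)) :=
  GRing.isLinear.Build R 'M[R]_(p, q) R *%R (dotp g) (dotp_is_linear g).

Lemma dotp_continuous (R : realType) p q (g : 'M[R]_(p.+1, q.+1)) :
  continuous (dotp g).
Proof.
move=> x; apply: (@cvg_dotp _ _ (nbhs x) _ _ _ (fun=> g) id); first exact: cvg_cst.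
exact: (@cvg_id _ (nbhs x)).
Qed.

Lemma is_diff_quadratic_remainder (R : realType) p q
    (f : 'M[R]_(p.+1, q.+1) -> R) (g z : 'M[R]_(p.+1, q.+1)) (C : R) :
  (forall h, `|f (z + h) - f z - dotp g h| <= C * `|h| ^+ 2) ->
  is_diff z f (dotp g).
Proof.
move=> fC.
have exp : f \o shift z = cst (f z) + dotp g +o_ (0 : 'M[R]_(p.+1, q.+1)) id.
  apply/eqaddoP => e e0.
  have C0 : 0 < `|C| + 1 by rewrite ltr_wpDl.
  have eC : 0 < e / (`|C| + 1) by rewrite divr_gt0.
  apply: (@filterS _ (nbhs (0 : 'M[R]_(p.+1, q.+1))) _ _ _ _ (near_dist_le 0 eC)) => h.
  rewrite subr0 ler_pdivlMr// => he.
  have -> : (f \o shift z - (cst (f z) + dotp g)) h = f (z + h) - f z - dotp g h.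
    by rewrite !fctE /= opprD addrA (addrC h).
  rewrite (le_trans (fC h))// expr2 mulrA ler_wpM2r//.
  rewrite (le_trans _ he)// mulrC ler_wpM2l// (le_trans (ler_norm _))//.
  by rewrite lerDl.
have dE := diff_unique (@dotp_continuous _ _ _ g) exp.
apply: DiffDef => //; apply/diff_locallyP; rewrite dE; split => //.
exact: dotp_continuous.
Qed.

Lemma is_diff_expansion (R : realType) p q (f : 'M[R]_(p.+1, q.+1) -> R)
    (g z : 'M[R]_(p.+1, q.+1)) (e : R) : is_diff z f (dotp g) -> 0 < e ->
  exists2 d, 0 < d & forall y, `|y - z| <= d ->
    `|f y - f z - dotp g (y - z)| <= e * `|y - z|.
Proof.
move=> [df dE] e0; have /diff_locallyP[_] := df; rewrite dE.
move=> /eqaddoP/(_ _ e0)/nbhs_ballP[d /= d0 hd]; exists (d / 2); first by rewrite divr_gt0.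
move=> y yz; have := hd (y - z); rewrite mx_norm_ball /ball_ /= sub0r normrN => h.
have : `|y - z| < d by rewrite (le_lt_trans yz)// ltr_pdivrMr// ltr_pMr// ltr1n.
move=> /h; rewrite !fctE /= subrK opprD addrA; exact.
Qed.

Lemma C1_quadratic (R : realType) m n (x P : state R m n) (C : R) :
  C1_with_gradient (fun y => dotp P y + C * dotp (y - x) (y - x))
    (fun y => P + (2 * C) *: (y - x)).
Proof.
split=> [z|z].
  apply: (@is_diff_quadratic_remainder _ _ _ _ _ _ (`|C| * (m.+1 * n.+1)%:R)) => h.
  rewrite (_ : z + h - x = (z - x) + h); last by rewrite addrAC.
  rewrite (dotp_sqrD (z - x) h) (dotpDr z h) (dotpDl P) dotpZl.
  rewrite (_ : _ - _ - _ = C * dotp h h); last by ring.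
  by rewrite normrM -mulrA ler_wpM2l// ger0_norm ?dotp_ge0// dotp_le_sqr.
apply: (cvgD (F := nbhs z)); first exact: cvg_cst.
apply: (cvgZl_tmp (F := nbhs z)).
by apply: (cvgB (F := nbhs z)); [exact: (@cvg_id _ (nbhs z))|exact: cvg_cst].
Qed.

Lemma quad_touch_subsolution (R : realType) m n H Omega
    (v : state R m n -> R) x P :
  viscosity_subsolution H Omega v -> Omega x -> quad_touch v x P ->
  v x + H x P <= 0.
Proof.
move=> vsub Ox [C tC]; have := vsub _ _ (C1_quadratic x P C) x Ox.
rewrite subrr scaler0 addr0; apply.
apply: (@filterS _ (nbhs x) _ _ _ _ tC) => y /=.
by rewrite dotp0l mulr0 addr0 (dotpDr y _ P) dotpNr; lra.
Qed.

(** The quotient in the definition of the Frechet superdifferential is at most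
    C |y - x|, which tends to 0. *)
Lemma quad_touch_frechet (R : realType) m n (v : state R m n -> R) x P :
  quad_touch v x P -> frechet_superdiff v x P.
Proof.
move=> [C tC]; rewrite /frechet_superdiff /=; apply/lee_addgt0Pr => e e0.
rewrite add0e; have C0 : 0 < `|C| + 1 by rewrite ltr_wpDl.
have smallx : \forall y \near x, enorm (y - x) <= e / (`|C| + 1).
  have Fx : (fun y => enorm (y - x)) @ nbhs x --> 0.
    have <- : enorm (x - x) = 0 by rewrite subrr /enorm dotp0l sqrtr0.
    apply: (@cvg_enorm _ _ (nbhs x)).
    by apply: (cvgB (F := nbhs x)); [exact: (@cvg_id _ (nbhs x))|exact: cvg_cst].
  by apply: (cvgr_le (F := nbhs x)) Fx _ _; rewrite divr_gt0.
pose V := [set y : state R m n | y != x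
  /\ v y <= v x + dotp P (y - x) + C * dotp (y - x) (y - x)
  /\ enorm (y - x) <= e / (`|C| + 1)].
apply: (@le_trans _ _ (ereal_sup [set ((v y - v x - dotp P (y - x)) / enorm (y - x))%:E | y in V])).
  apply: ereal_inf_lbound; exists V => //.
  rewrite /dnbhs /within /=.
  apply: (@filterS2 _ (nbhs x) _ _ _ _ _ tC smallx) => y h1 h2 yx.
  by split => //; apply/eqP.
apply: ge_ereal_sup => _ [y [yx [h1 h2]] <-]; rewrite lee_fin.
have y0 : 0 < enorm (y - x) by rewrite enorm_gt0// subr_eq0.
rewrite ler_pdivrMr//; rewrite ler_pdivlMr// in h2.
apply: (@le_trans _ _ (C * dotp (y - x) (y - x))); first by lra.
rewrite -enorm_sqr expr2 mulrA ler_wpM2r ?enorm_ge0//.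
rewrite (le_trans _ h2)// mulrC ler_wpM2l ?enorm_ge0// (le_trans (ler_norm _))//.
by rewrite lerDl.
Qed.

(** Compare the touching inequality in the direction - P with the Lipschitz bound
    and let the step tend to 0. *)
Lemma quad_touch_bounded (R : realType) p q
    (w : 'M[R]_(p.+1, q.+1) -> R) (L : R) x P :
  (forall x y, `|w x - w y| <= L * `|x - y|) -> 0 < L -> quad_touch w x P ->
  `|P| <= L.
Proof.
move=> wL L0 [C /nbhs_ballP[d /= d0 hd]].
have [->|P0] := eqVneq P 0; first by rewrite normr0 ltW.
have PP : 0 < dotp P P by rewrite -enorm_sqr exprn_gt0// enorm_gt0.
have PN : 0 < `|P| by rewrite normr_gt0.
have key s : 0 < s -> s * `|P| < d -> dotp P P <= L * `|P| + s * (`|C| * dotp P P).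
  move=> s0 sd; have /= := hd (x - s *: P).
  have xs : x - (x - s *: P) = s *: P by rewrite opprB addrC subrK.
  rewrite mx_norm_ball /ball_ /= xs normrZ gtr0_norm// => /(_ sd).
  have -> : x - s *: P - x = - s *: P by rewrite addrAC subrr sub0r scaleNr.
  rewrite dotpZl !dotpZr.
  have := wL x (x - s *: P); rewrite xs normrZ gtr0_norm// => h1 h2.
  have h3 : s * dotp P P <= L * (s * `|P|) + C * (s * (s * dotp P P)).
    have := ler_norm (w x - w (x - s *: P)); lra.
  rewrite -(ler_pM2l s0) (le_trans h3)// mulrDr mulrCA lerD2l.
  have := ler_wpM2r (mulr_ge0 (ltW s0) (mulr_ge0 (ltW s0) (ltW PP))) (ler_norm C).
  lra.
have PL : dotp P P <= L * `|P|.
  apply/ler_addgt0Pr => e e0.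
  have CP : 0 <= `|C| * dotp P P by rewrite mulr_ge0// ltW.
  pose s := Num.min (d / (2 * `|P|)) (e / (`|C| * dotp P P + 1)).
  have s0 : 0 < s by rewrite lt_min !divr_gt0 ?mulr_gt0// ltr_wpDl.
  have sd : s * `|P| < d.
    have : s <= d / (2 * `|P|) by rewrite ge_min lexx.
    rewrite ler_pdivlMr ?mulr_gt0//; have := mulr_gt0 s0 PN; lra.
  have := key s s0 sd.
  have : s <= e / (`|C| * dotp P P + 1) by rewrite ge_min lexx orbT.
  rewrite ler_pdivlMr ?ltr_wpDl// mulrDr mulr1; lra.
rewrite -(ler_pM2r PN) (le_trans _ PL)// -expr2 -enorm_sqr.
by rewrite ler_sqr ?nnegrE ?enorm_ge0// norm_le_enorm.
Qed.

(** * Finite minima, value functions and the Hamiltonian *)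

Lemma minf_le (R : realType) m (F : 'I_m.+1 -> R) i : minf F <= F i.
Proof. exact: (@Order.TotalTheory.bigmin_inf _ _ _ _ i). Qed.

Lemma minf_attained (R : realType) m (F : 'I_m.+1 -> R) : exists i, minf F = F i.
Proof.
rewrite /minf; elim/big_ind: _ => [|x y [i ->] [j ->]|i _]; [by exists ord0| |by exists i].
by rewrite minEle; case: ifP => _; [exists i|exists j].
Qed.

Lemma minf_lipschitz (R : realType) m p q
    (us : 'I_m.+1 -> 'M[R]_(p.+1, q.+1) -> R) L :
  (forall i x y, `|us i x - us i y| <= L * `|x - y|) ->
  forall x y, `|minf (us ^~ x) - minf (us ^~ y)| <= L * `|x - y|.
Proof.
move=> uL x y; rewrite ler_norml; apply/andP; split.
  have [i ->] := minf_attained (us ^~ x).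
  have := minf_le (us ^~ y) i; have := uL i x y; rewrite ler_norml => /andP[+ _].
  by move=> /=; lra.
have [i ->] := minf_attained (us ^~ y).
have := minf_le (us ^~ x) i; have := uL i x y; rewrite ler_norml => /andP[_].
by move=> /=; lra.
Qed.

Lemma sup_ge0 (R : realType) (A : set R) : (forall x, A x -> 0 <= x) -> 0 <= sup A.
Proof.
move=> A0; have [hA|nA] := pselect (has_sup A); last by rewrite sup_out.
have [x Ax] := hA.1; rewrite (le_trans (A0 x Ax))//.
by apply: sup_upper_bound.
Qed.

Lemma inf_ge0 (R : realType) (A : set R) : (forall x, A x -> 0 <= x) -> 0 <= inf A.
Proof.
move=> A0; have [hA|nA] := pselect (A !=set0); first exact: lb_le_inf.
by rewrite inf_out// => -[].
Qed.

Lemma cost_ge0 (R : realType) m n (G : game R m n) S x a b : 0 <= cost G S x a b.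
Proof.
rewrite /cost; set s := hitting_time _ _.
have : (0 <= s)%E.
  by apply: le_ereal_inf_tmp => _ [t [t0 _] <-]; rewrite lee_fin.
case: s => [t| |] //=; rewrite lee_fin => t0.
by rewrite subr_ge0 -expR0 ler_expR oppr_le0.
Qed.

(** Costs are nonnegative, and the conventions sup = 0 and inf = 0 for sets without
    a supremum or an infimum preserve this. *)
Lemma value_function_ge0 (R : realType) m n (G : game R m n) S v x :
  is_value_function G S v -> 0 <= v x.
Proof.
move=> /(_ x)[<- _]; apply: sup_ge0 => _ [beta _ <-].
by apply: inf_ge0 => _ [a _ <-]; exact: cost_ge0.
Qed.

Lemma targetP (R : realType) m n (r : R) (x : state R m n) :
  target r x <-> exists i, target_of r i x.
Proof.
split => [|[i xi]]; rewrite /target /target_of /=.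
  by have [i ->] := minf_attained (fun i => enorm (row i x)); exists i.
by apply: le_trans xi; exact: (minf_le (fun i => enorm (row i x))).
Qed.

Lemma target_of_open_compl (R : realType) m n (r : R) i (x : state R m n) :
  ~ target_of r i x -> \forall y \near x, ~ target_of r i y.
Proof.
move=> nx; have rx : r < enorm (row i x) by rewrite ltNge; apply/negP.
have cx : (fun y => enorm (row i y)) @ nbhs x --> enorm (row i x).
  apply: (@cvg_enorm _ _ (nbhs x)); apply: (@cvg_row _ _ (nbhs x)).
  exact: (@cvg_id _ (nbhs x)).
have FF : Filter (nbhs x) := nbhs_filter x.
have H := @cvgr_gt R _ (nbhs x) FF _ (enorm (row i x)) cx r rx.
by apply: (@filterS _ (nbhs x) FF _ _ _ H) => y ry ty; move: ry; rewrite ltNge ty.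
Qed.

Lemma cvg_hamiltonian (R : realType) m n (G : game R m n) T (F : set_system T)
    (FF : Filter F) (X P : T -> state R m n) x p :
  hypH G -> X @ F --> x -> P @ F --> p ->
  hamiltonian G (X t) (P t) @[t --> F] --> hamiltonian G x p.
Proof.
move=> [_ _ lipG _] Xx Pp.
have gc i : gcoef G i (X t) @[t --> F] --> gcoef G i x.
  have [gl _ _] := lipG i.
  by apply: cvg_comp Xx _; exact: lipschitz_continuous gl _.
have hc i : hcoef G i (X t) @[t --> F] --> hcoef G i x.
  have [_ hl _] := lipG i.
  by apply: cvg_comp Xx _; exact: lipschitz_continuous hl _.
have lc i : ldrift G i (X t) @[t --> F] --> ldrift G i x.
  have [_ _ ll] := lipG i.
  by apply: cvg_comp Xx _; exact: lipschitz_continuous ll _.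
rewrite /hamiltonian; apply: cvgB; last exact: cvg_cst.
apply: cvgB; last first.
  by apply: cvg_sumr => i _; apply: cvg_dotp => //; exact: cvg_row.
apply: cvgB; apply: cvgM; try exact: cvg_cst.
  by apply: cvg_sumr => i _; apply: cvgM => //; apply: cvg_enorm; exact: cvg_row.
apply: cvg_enorm; apply: cvg_sumr => i _.
by apply: cvgZ => //; exact: cvg_row.
Qed.

(** * The superdifferential of a minimum *)

(** The rule for a single function, with eta = L and g = 0: the only weight is 1. *)
Lemma quad_touch_dense (R : realType) p q (w : 'M[R]_(p.+1, q.+1) -> R) L x0 e :
  0 < L -> (forall x y, `|w x - w y| <= L * `|x - y|) -> 0 < e ->
  exists x P, `|x - x0| <= e /\ quad_touch w x P.
Proof.
move=> L0 wL e0; have e2 : 0 < e / 2 by rewrite divr_gt0.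
have [||X [lam [P [Xx _ lam1 tP _]]]] := @fuzzy_min_rule R unit [set: unit]%SET p q
  (fun=> w) L L (e / 2) x0 (w x0) 0 (fun=> wL) L0 L0 e2.
- by [].
- move=> x _; exists tt; first by rewrite inE.
  rewrite dotp0l addr0 -lerBlDl (le_trans (ler_norm _))// (le_trans (wL _ _))//.
  by apply: ler_wpM2l; [exact: ltW|exact: norm_le_enorm].
exists (X tt), (P tt); split.
  by rewrite (le_trans (Xx tt))// mulrC mulfVK.
apply: tP; first by rewrite inE.
by move: lam1; rewrite (bigD1 tt) ?inE//= big1 ?addr0 => [->|[]]; rewrite ?eqxx ?andbF.
Qed.

(** Only the active functions are retained, since the others stay above the
    minimum near x0.  An active function of weight 0 receives an arbitrary nearby
    touching point, which does not change the convex combination. *)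
Lemma min_touch_approx (R : realType) m n (us : 'I_m.+1 -> state R m n -> R) L
    (phi : state R m n -> R) (g x0 : state R m n) :
  0 < L -> (forall i x y, `|us i x - us i y| <= L * `|x - y|) ->
  is_diff x0 phi (dotp g) ->
  (\forall y \near x0, minf (us ^~ y) - phi y <= minf (us ^~ x0) - phi x0) ->
  forall e, 0 < e ->
  exists d : ('I_m.+1 -> state R m n) * ('I_m.+1 -> R)
    * ('I_m.+1 -> state R m n),
  [/\ forall i, `|d.1.1 i - x0| <= e,
      forall i, 0 <= d.1.2 i, \sum_(i in active us x0) d.1.2 i = 1,
      forall i, i \in active us x0 -> quad_touch (us i) (d.1.1 i) (d.2 i)
    & `|\sum_(i in active us x0) d.1.2 i *: d.2 i - g| <= e].
Proof.
move=> L0 uL dphi locmax e e0.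
have e4 : 0 < e / 4 by rewrite divr_gt0.
have [d1 d10 hd1] := is_diff_expansion dphi e4.
have /nbhs_ballP[d2 /= d20 hd2] := locmax.
have [d3 d30 hd3] : exists2 d3, 0 < d3 & forall y, `|y - x0| < d3 ->
    forall i, i \notin active us x0 -> minf (us ^~ y) < us i y.
  (* the value 1 keeps the gap positive when every function is active *)
  pose gap := \big[Num.min/1]_(i | i \notin active us x0) (us i x0 - minf (us ^~ x0)).
  have gap0 : 0 < gap.
    rewrite /gap; elim/big_ind: _ => //= [x y ? ?|i]; first by rewrite lt_min; apply/andP.
    by rewrite inE => ia; rewrite subr_gt0 lt_neqAle eq_sym ia (minf_le (us ^~ x0)).
  exists (gap / (2 * L)); first by rewrite divr_gt0// mulr_gt0.
  move=> y; rewrite ltr_pdivlMr ?mulr_gt0// => yx i ia.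
  have gi : gap <= us i x0 - minf (us ^~ x0) by apply: bigmin_le_cond.
  have := uL i x0 y; have := minf_lipschitz uL y x0.
  rewrite (distrC x0 y) => h1 h2.
  have := le_trans (ler_norm _) h1; have := le_trans (ler_norm _) h2; lra.
pose rho := Num.min (e / 2) (Num.min d1 (Num.min (d2 / 2) (d3 / 2))).
have rho0 : 0 < rho by rewrite !lt_min !divr_gt0// d10.
have rhoe : 2 * rho <= e.
  by rewrite mulrC -ler_pdivlMr// /rho ge_min lexx.
have [||X [lam [P [Xx lam0 lam1 tP sP]]]] := @fuzzy_min_rule R _ (active us x0) m n us L
  (e / 4) rho x0 (minf (us ^~ x0)) g uL L0 e4 rho0.
- by move=> i _; exact: (minf_le (us ^~ x0)).
- move=> y; rewrite !le_min => /and4P[_ yd1 yd2 yd3].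
  have [i iy] := minf_attained (us ^~ y).
  exists i.
    apply: contraT => ia; have := hd3 y _ i ia; rewrite iy ltxx => -> //.
    by rewrite (le_lt_trans yd3)// ltr_pdivrMr// ltr_pMr// ltr1n.
  have := hd2 y; rewrite mx_norm_ball /ball_ /= distrC => h.
  have {}h : minf (us ^~ y) - phi y <= minf (us ^~ x0) - phi x0.
    by apply: h; rewrite (le_lt_trans yd2)// ltr_pdivrMr// ltr_pMr// ltr1n.
  have h2 := le_trans (ler_norm _) (hd1 y yd1).
  have := ler_wpM2l (ltW e4) (norm_le_enorm (y - x0)).
  by rewrite -iy; lra.
have /choice[Y HY] : forall i, exists d : state R m n * state R m n,
    `|d.1 - x0| <= e /\ quad_touch (us i) d.1 d.2.
  move=> i; have [x [Q [? ?]]] := quad_touch_dense x0 L0 (uL i) e0.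
  by exists (x, Q).
exists ((fun i => if 0 < lam i then X i else (Y i).1), lam,
  fun i => if 0 < lam i then P i else (Y i).2); split => //=.
- by move=> i; case: ifP => _; [rewrite (le_trans (Xx i))|exact: (HY i).1].
- by move=> i iI; case: ifP => li; [exact: tP|exact: (HY i).2].
- rewrite (_ : \sum_(i in active us x0) _ = \sum_(i in active us x0) lam i *: P i).
    by rewrite (le_trans sP)// mulrC mulfVK.
  apply: eq_bigr => i _; case: ifPn => //; rewrite -leNgt => li.
  have -> : lam i = 0 by apply/eqP; rewrite eq_le li lam0.
  by rewrite !scale0r.
Qed.

(** Limits of touching gradients, in a form that an ultrafilter limit yields
    directly; [touch_limit_seq] recovers sequences. *)
Definition touch_limit (R : realType) p q (w : 'M[R]_(p.+1, q.+1) -> R)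
    (x0 xi : 'M[R]_(p.+1, q.+1)) : Prop :=
  forall e : R, 0 < e ->
    exists x P, [/\ quad_touch w x P, `|x - x0| <= e & `|P - xi| <= e].

(** The exact rule: the error e of [min_touch_approx] tends to 0 along an
    ultrafilter finer than the right neighbourhoods of 0. *)
Lemma min_superdiff_rule (R : realType) m n (us : 'I_m.+1 -> state R m n -> R) L
    (phi : state R m n -> R) (g x0 : state R m n) :
  0 < L -> (forall i x y, `|us i x - us i y| <= L * `|x - y|) ->
  is_diff x0 phi (dotp g) ->
  (\forall y \near x0, minf (us ^~ y) - phi y <= minf (us ^~ x0) - phi x0) ->
  exists (lam : 'I_m.+1 -> R) (xi : 'I_m.+1 -> state R m n),
  [/\ forall i, 0 <= lam i, \sum_(i in active us x0) lam i = 1,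
      \sum_(i in active us x0) lam i *: xi i = g
    & forall i, i \in active us x0 -> touch_limit (us i) x0 (xi i)].
Proof.
move=> L0 uL dphi locmax.
set I := active us x0.
have /choice[D HD] : forall e : R, exists d : ('I_m.+1 -> state R m n) * ('I_m.+1 -> R)
    * ('I_m.+1 -> state R m n), 0 < e ->
  [/\ forall i, `|d.1.1 i - x0| <= e,
      forall i, 0 <= d.1.2 i, \sum_(i in I) d.1.2 i = 1,
      forall i, i \in I -> quad_touch (us i) (d.1.1 i) (d.2 i)
    & `|\sum_(i in I) d.1.2 i *: d.2 i - g| <= e].
  move=> e; have [e0|e0] := ltP 0 e; last by exists (fun=> x0, fun=> 0, fun=> x0).
  by have [d hd] := min_touch_approx L0 uL dphi locmax e0; exists d.
have [U [UU FU]] := @ultraFilterLemma _ (0 : R)^'+ _.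
have U0 : \forall e \near U, 0 < e by apply: FU; exact: nbhs_right_gt.
have Ule c : 0 < c -> \forall e \near U, e <= c.
  by move=> c0; apply: FU; exact: nbhs_right_le.
have /choice[lam Ulam] : forall i, exists a : R, i \in I -> (D e).1.2 i @[e --> U] --> a.
  move=> i; have [iI|] := boolP (i \in I); last by exists 0.
  have [|a ?] := @ultra_bounded_cvg R _ U UU (fun e => (D e).1.2 i) 1; last by exists a.
  apply: filterS U0 => e /HD[_ l0 l1 _ _]; rewrite ger0_norm// -l1 (bigD1 i)//=.
  by rewrite lerDl sumr_ge0.
have /choice[xi Uxi] : forall i, exists a : state R m n, i \in I -> (D e).2 i @[e --> U] --> a.
  move=> i; have [iI|] := boolP (i \in I); last by exists 0.
  have [|a ? _] := @ultra_bounded_cvg_mx R _ U UU _ _ (fun e => (D e).2 i) 0 L; last by exists a.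
  apply: filterS U0 => e /HD[_ _ _ tP _]; rewrite subr0.
  by apply: quad_touch_bounded (uL i) L0 (tP i iI).
exists (fun i => if i \in I then lam i else 0), xi; split.
- move=> i; case: ifP => // iI; apply: cvgr_to_ge (Ulam i iI) _.
  by apply: filterS U0 => e /HD[].
- rewrite (eq_bigr lam) => [|i -> //].
  have s1 : (\sum_(i in I) (D e).1.2 i) @[e --> U] --> \sum_(i in I) lam i.
    by apply: cvg_sumr => i iI; exact: Ulam.
  apply: (cvg_unique _ s1) => //; apply/cvgrPdist_le => c c0.
  by apply: filterS U0 => e /HD[_ _ -> _ _]; rewrite subrr normr0 ltW.
- rewrite (eq_bigr (fun i => lam i *: xi i)) => [|i -> //].
  have s1 : (\sum_(i in I) (D e).1.2 i *: (D e).2 i) @[e --> U] --> \sum_(i in I) lam i *: xi i.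
    by apply: cvg_sumr => i iI; apply: cvgZ; [exact: Ulam|exact: Uxi].
  apply: (cvg_unique _ s1) => //; apply/cvgrPdist_le => c c0.
  apply: filterS2 U0 (Ule c c0) => e e0 ec; have [_ _ _ _] := HD e e0.
  by rewrite distrC => /le_trans; apply.
- move=> i iI e e0.
  have /cvgrPdist_le/(_ e e0) H1 := Uxi i iI.
  have [c [[c0 ce] cP]] := filter_ex (filterI (filterI U0 (Ule e e0)) H1).
  have [Xx _ _ tP _] := HD c c0.
  exists ((D c).1.1 i), ((D c).2 i); split; [exact: tP|exact: le_trans (Xx i) ce|].
  by rewrite distrC.
Qed.

(** * Viscosity properties of the minimum *)

Lemma cvg_le_harmonic (R : realType) p q (xs : nat -> 'M[R]_(p, q)) x :
  (forall k, `|xs k - x| <= k.+1%:R^-1) -> xs @ \oo --> x.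
Proof.
move=> xsx; apply/cvgrPdist_le => e e0.
have /cvgrPdist_le/(_ e e0) := @cvg_harmonic R.
apply: filterS => k; rewrite sub0r normrN /harmonic /= ger0_norm// => ke.
by rewrite distrC (le_trans (xsx k)).
Qed.

Lemma touch_limit_seq (R : realType) p q (w : 'M[R]_(p.+1, q.+1) -> R) x0 xi :
  touch_limit w x0 xi -> exists xs ps : nat -> 'M[R]_(p.+1, q.+1),
  [/\ forall k, quad_touch w (xs k) (ps k), xs @ \oo --> x0 & ps @ \oo --> xi].
Proof.
move=> h.
have /choice[d hd] : forall k : nat, exists d : 'M[R]_(p.+1, q.+1) * 'M[R]_(p.+1, q.+1),
    [/\ quad_touch w d.1 d.2, `|d.1 - x0| <= k.+1%:R^-1 & `|d.2 - xi| <= k.+1%:R^-1].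
  move=> k; have k0 : 0 < (k.+1%:R : R)^-1 by rewrite invr_gt0.
  by have [x [P [? ? ?]]] := h _ k0; exists (x, P).
exists (fun k => (d k).1), (fun k => (d k).2); split.
- by move=> k; have [] := hd k.
- by apply: cvg_le_harmonic => k; have [] := hd k.
- by apply: cvg_le_harmonic => k; have [] := hd k.
Qed.

Lemma touch_limit_limiting (R : realType) m n (w : state R m n -> R) x0 xi :
  touch_limit w x0 xi -> limiting_superdiff w x0 xi.
Proof.
move=> /touch_limit_seq[xs [ps [tP xsx psx]]]; exists xs, ps; split => // k.
exact: quad_touch_frechet.
Qed.

(** The inequality holds at the touching points because a quadratic function is an
    admissible test function; it passes to the limit because H is continuous. *)
Lemma touch_limit_subsolution (R : realType) m n (G : game R m n) Omega
    (w : state R m n -> R) x0 xi : hypH G -> continuous w ->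
  (\forall y \near x0, Omega y) ->
  viscosity_subsolution (hamiltonian G) Omega w ->
  touch_limit w x0 xi -> w x0 + hamiltonian G x0 xi <= 0.
Proof.
move=> hG wc Ox wsub /touch_limit_seq[xs [ps [tP xsx psx]]].
have H : (fun k => w (xs k) + hamiltonian G (xs k) (ps k)) @ \oo -->
    w x0 + hamiltonian G x0 xi.
  apply: cvgD; last exact: cvg_hamiltonian.
  by apply: cvg_comp xsx _; exact: wc.
have Oxs : \forall k \near \oo, Omega (xs k) by exact: xsx _ Ox.
apply: cvgr_to_le H _; apply: filterS Oxs => k Ok.
exact: quad_touch_subsolution wsub Ok (tP k).
Qed.

(** The gradient of the test function is a convex combination of limits xi i of
    touching gradients.  Each of them satisfies the inequality for the active us i,
    whose value at x is the minimum, and the convexity of H along the xi i averages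
    these inequalities. *)
Lemma min_subsolution (R : realType) m n (G : game R m n)
    (Omega : set (state R m n))
    (Omegas : 'I_m.+1 -> set (state R m n)) (us : 'I_m.+1 -> state R m n -> R) L :
  hypH G -> 0 < L -> (forall i x y, `|us i x - us i y| <= L * `|x - y|) ->
  (forall x, Omega x -> forall i, \forall y \near x, Omegas i y) ->
  (forall i, viscosity_subsolution (hamiltonian G) (Omegas i) (us i)) ->
  (forall x, Omega x ->
     forall (lambda : 'I_m.+1 -> R) (xi : 'I_m.+1 -> state R m n),
       (forall i, i \in active us x -> 0 <= lambda i) ->
       \sum_(i in active us x) lambda i = 1 ->
       (forall i, i \in active us x -> limiting_superdiff (us i) x (xi i)) ->
       hamiltonian G x (\sum_(i in active us x) lambda i *: xi i)
         <= \sum_(i in active us x) lambda i * hamiltonian G x (xi i)) ->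
  viscosity_subsolution (hamiltonian G) Omega (fun x => minf (us ^~ x)).
Proof.
move=> hG L0 uL OO usub hconv phi dphi [dP _] x Ox locmax.
have [lam [xi [lam0 lam1 <- tP]]] := min_superdiff_rule L0 uL (dP x) locmax.
have Hconv := hconv x Ox lam xi (fun i _ => lam0 i) lam1
  (fun i iI => touch_limit_limiting (tP i iI)).
suff : \sum_(i in active us x) lam i * hamiltonian G x (xi i) <= - minf (us ^~ x).
  by rewrite -subr_ge0 -opprD oppr_ge0 addrC => ?; lra.
rewrite -[leRHS]mul1r -lam1 mulr_suml; apply: ler_sum => i iI.
rewrite ler_wpM2l//; have := touch_limit_subsolution hG (klipschitz_continuous L0 (uL i))
  (OO x Ox i) (usub i) (tP i iI).
by move: iI; rewrite inE => /eqP ->; lra.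
Qed.

Lemma min_supersolution (R : realType) m n H (Omega : set (state R m n))
    (Omegas : 'I_m.+1 -> set (state R m n)) (us : 'I_m.+1 -> state R m n -> R) :
  (forall x, Omega x -> forall i, Omegas i x) ->
  (forall i, viscosity_supersolution H (Omegas i) (us i)) ->
  viscosity_supersolution H Omega (fun x => minf (us ^~ x)).
Proof.
move=> OO usup phi dphi C1 x Ox locmin.
have [i xi] := minf_attained (us ^~ x); rewrite xi.
apply: (usup i phi dphi C1 x (OO x Ox i)).
apply: (@filterS _ (nbhs x) _ _ _ _ locmin) => y; rewrite xi => h.
by rewrite (le_trans h)// lerD2r (minf_le (us ^~ y)).
Qed.

Unset Implicit Arguments.

(* The hypotheses known_* are the background facts on the value functions that
   are taken as known under (H). *)
Theorem theorem3p1 (R : realType) (m n : nat) (G : game R m n) (r : R)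
  (u : state R m n -> R) (us : 'I_m.+1 -> state R m n -> R)
  (hG : hypH G) (hr : 0 <= r)
  (hu : is_value_function G (target r) u)
  (hus : forall i, is_value_function G (target_of r i) (us i))
  (known_u : unif_continuous u /\ solves_dirichlet G (target r) u)
  (known_unique : forall v : state R m n -> R,
     unif_continuous v -> solves_dirichlet G (target r) v ->
     forall x, v x = u x)
  (known_us : forall i, solves_dirichlet G (target_of r i) (us i))
  (known_us_lipschitz : forall i, lipschitz (us i))
  (hconv : forall x, ~ target r x ->
     forall (lambda : 'I_m.+1 -> R) (xi : 'I_m.+1 -> state R m n),
       (forall i, i \in active us x -> 0 <= lambda i) ->
       \sum_(i in active us x) lambda i = 1 ->
       (forall i, i \in active us x -> limiting_superdiff (us i) x (xi i)) ->
       hamiltonian G x (\sum_(i in active us x) lambda i *: xi i)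
         <= \sum_(i in active us x) lambda i * hamiltonian G x (xi i)) :
  forall x, ~ target r x -> u x = minf (fun i => us i x).
Proof.
have [L L0 uL] := lipschitz_family known_us_lipschitz.
have vL := minf_lipschitz uL.
have outside y : ~ target r y -> forall i, ~ target_of r i y.
  by move=> ny i ty; apply: ny; apply/targetP; exists i.
move=> x _; symmetry; apply: (known_unique (fun y => minf (us ^~ y))).
  exact: klipschitz_unif_continuous L0 vL.
split=> [y /targetP[i yi]|].
  apply/eqP; rewrite eq_le; apply/andP; split.
    by rewrite -((known_us i).1 y yi) (minf_le (us ^~ y)).
  have [j ->] := minf_attained (us ^~ y).
  exact: value_function_ge0 (hus j).
split.
- by move=> y _; exact: klipschitz_continuous L0 vL y.
- apply: (@min_subsolution _ _ _ _ _ (fun i => ~` target_of r i) _ L) => //.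
    by move=> y ny i; apply: target_of_open_compl; exact: outside.
  by move=> i; have [_ [_ sub _]] := known_us i.
- apply: (@min_supersolution _ _ _ _ _ (fun i => ~` target_of r i)).
    by move=> y ny i; exact: outside.
  by move=> i; have [_ [_ _ sup]] := known_us i.
Qed.
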